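(* Let $\mathcal{P}=\{p_1,\dots,p_m\}$ be a set of $m\ge 4$ points in $\mathbb{E}^3$, not all collinear, and let $r>0$. Suppose $\mathcal{P}$ can be enclosed in a circular cylinder $\mathcal{C}$ of radius $r$. Then there exists a circular cylinder $\mathcal{C}'$ of radius $r$ enclosing all points of $\mathcal{P}$, such that $\mathcal{C}$ can be transformed into $\mathcal{C}'$ by a continuous motion (of the axis, keeping the radius $r$), and such that one of the following holds: (i) the surface $\mathcal{C}'$ passes through at least four non-collinear points of $\mathcal{P}$; or (ii) the surface $\mathcal{C}'$ passes through three non-collinear points of $\mathcal{P}$, and for two of these three points, say $p,q$, the axis $\ell$ of $\mathcal{C}'$ satisfies one of: (a) $\ell$ lies on the cylinder naturally defined by the spheres $S(p,r)$, $S(q,r)$, i.e. $\ell$ is parallel to $q-p$ and at distance $r$ from the line through $p$ and $q$; (b) the spheres $S(p,r)$ and $S(q,r)$ are disjoint (i.e. $\|p-q\|>2r$) and $\ell$ lies on the double cone naturally defined by them, i.e. $\ell$ passes through the midpoint $(p+q)/2$ and is tangent to both spheres; (c) the spheres $S(p,r)$ and $S(q,r)$ are not disjoint, and $\ell$ is tangent to both spheres and is contained in the plane consisting of the points equidistant from $p$ and $q$.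
   Context: $\mathbb{E}^n$ denotes $\mathbb{R}^n$ with the standard scalar product and Euclidean norm. A (circular) cylinder in $\mathbb{E}^n$ with axis a line $\ell$ and radius $\rho>0$ is the set $\mathrm{bd}(\ell+\rho\mathbb{B}^n)$, where $\mathbb{B}^n$ is the closed unit ball, $+$ is Minkowski sum and $\mathrm{bd}$ denotes boundary; equivalently, the set of points at distance exactly $\rho$ from $\ell$. A set $P$ is enclosed in a cylinder $\mathcal{C}$ if $P$ is contained in the convex hull of $\mathcal{C}$ (i.e. every point of $P$ has distance at most $\rho$ from $\ell$). ''The surface passes through a point'' means the point lies on the cylinder (distance exactly $\rho$ from the axis). $S(x,r)$ denotes the sphere of radius $r$ centered at $x$. *)

(* Defs.v *)
From Stdlib Require Import Reals List.
Open Scope R_scope.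

Definition pt := (R * R * R)%type.
Definition px (p : pt) : R := fst (fst p).
Definition py (p : pt) : R := snd (fst p).
Definition pz (p : pt) : R := snd p.
Definition mkpt (x y z : R) : pt := (x, y, z).

Definition vadd (p q : pt) : pt := mkpt (px p + px q) (py p + py q) (pz p + pz q).
Definition vsub (p q : pt) : pt := mkpt (px p - px q) (py p - py q) (pz p - pz q).
Definition vscale (k : R) (p : pt) : pt := mkpt (k * px p) (k * py p) (k * pz p).
Definition dot (p q : pt) : R := px p * px q + py p * py q + pz p * pz q.
Definition norm (p : pt) : R := sqrt (dot p p).
Definition dist (p q : pt) : R := norm (vsub p q).
Definition zero : pt := mkpt 0 0 0.

(* The line through a with direction d (d <> 0 is assumed where used). *)
Definition on_line (a d x : pt) : Prop := exists t : R, x = vadd a (vscale t d).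

(* distance from x to the line (a,d) is at most rho (the infimum is attained) *)
Definition dist_line_le (a d x : pt) (rho : R) : Prop :=
  exists y, on_line a d y /\ dist x y <= rho.

Definition dist_line_eq (a d x : pt) (rho : R) : Prop :=
  (exists y, on_line a d y /\ dist x y = rho) /\
  (forall y, on_line a d y -> rho <= dist x y).

Definition enclosed (P : list pt) (a d : pt) (r : R) : Prop :=
  forall x, In x P -> dist_line_le a d x r.

Definition on_cylinder (a d : pt) (r : R) (x : pt) : Prop := dist_line_eq a d x r.

Definition collinear (S : list pt) : Prop :=
  exists a d, d <> zero /\ forall x, In x S -> on_line a d x.

Definition motion (P : list pt) (r : R) (a0 d0 a1 d1 : pt) : Prop :=
  exists (a d : R -> pt),
    (forall t, continuity_pt (fun s => px (a s)) t /\
               continuity_pt (fun s => py (a s)) t /\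
               continuity_pt (fun s => pz (a s)) t /\
               continuity_pt (fun s => px (d s)) t /\
               continuity_pt (fun s => py (d s)) t /\
               continuity_pt (fun s => pz (d s)) t) /\
    a 0 = a0 /\ d 0 = d0 /\ a 1 = a1 /\ d 1 = d1 /\
    (forall t, 0 <= t <= 1 -> d t <> zero /\ enclosed P (a t) (d t) r).

Definition cond_a (p q a d : pt) (r : R) : Prop :=
  (exists k, d = vscale k (vsub q p)) /\ dist_line_eq p (vsub q p) a r.

Definition cond_b (p q a d : pt) (r : R) : Prop :=
  dist p q > 2 * r /\
  on_line a d (vscale (/2) (vadd p q)) /\
  dist_line_eq a d p r /\ dist_line_eq a d q r.

Definition cond_c (p q a d : pt) (r : R) : Prop :=
  dist p q <= 2 * r /\
  dist_line_eq a d p r /\ dist_line_eq a d q r /\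
  (forall x, on_line a d x -> dist x p = dist x q).

(* Main.v *)
(** Slide the axis until the cylinder touches a point [p], then roll it around [p] with fixed direction
    until it touches a second point [q] with a different projection. The common tangent lines of
    [S(p,r)] and [S(q,r)] are parametrized by their angle [al] with [pq] and the rotation [ph] about [pq].
    Decreasing [al] at fixed [ph] either produces a third contact or ends on the cylinder of (a), where a
    rotation by [PI] about [pq] must produce one.

    With three contacts [p, q, s], follow the curve of common tangents until a fourth contact or a special
    position occurs. If [x_p, x_q, x_s] are the radii at the contact points and [u] the direction of the
    axis, the velocity field turning [u] orthogonally to [x_p] changes [dist(s, axis)^2] at a rate
    proportional to [<s - q, u> * det (x_s, x_p, u)], and symmetrically for [q]. Both rates are nonzero
    away from the special positions, so along the curve [|d ph / d al|] never crosses an explicit bound: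
    the curve is a Lipschitz graph either over [al], which can be followed down to [al = 0], case (a), or
    over [ph], which can be followed until [u] lies in the plane [pqs]. In that plane three points of a
    circle project to a line, so two of them coincide, which is case (a) for another pair. *)

From Stdlib Require Import Reals List Lra Classical Ranalysis5.
From Coquelicot Require Import Coquelicot.
Require Import Defs.
Open Scope R_scope.

(** * Distance to a line *)

Lemma pt_ext (p q : pt) : px p = px q -> py p = py q -> pz p = pz q -> p = q.
Proof.
destruct p as [[? ?] ?], q as [[? ?] ?]; unfold px, py, pz; simpl; congruence.
Qed.

Ltac vunfold := unfold dot, vadd, vsub, vscale, zero, mkpt, px, py, pz in *; simpl in *.
Ltac vring := unfold dot, vadd, vsub, vscale, zero, mkpt, px, py, pz; simpl; intros; try ring.

Lemma dot_sym x y : dot x y = dot y x.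
Proof. vring. Qed.
Lemma dot_add_l x y z : dot (vadd x y) z = dot x z + dot y z.
Proof. vring. Qed.
Lemma dot_sub_l x y z : dot (vsub x y) z = dot x z - dot y z.
Proof. vring. Qed.
Lemma dot_scale_l k x z : dot (vscale k x) z = k * dot x z.
Proof. vring. Qed.
Lemma dot_add_r x y z : dot z (vadd x y) = dot z x + dot z y.
Proof. vring. Qed.
Lemma dot_sub_r x y z : dot z (vsub x y) = dot z x - dot z y.
Proof. vring. Qed.
Lemma dot_scale_r k x z : dot z (vscale k x) = k * dot z x.
Proof. vring. Qed.

Ltac dexp := repeat first [rewrite dot_add_l | rewrite dot_sub_l | rewrite dot_scale_l
  | rewrite dot_add_r | rewrite dot_sub_r | rewrite dot_scale_r].

Lemma dot_pos x : 0 <= dot x x.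
Proof. vring; nra. Qed.

Lemma dot_self_0 x : dot x x = 0 -> x = zero.
Proof. intros H; apply pt_ext; revert H; vring; nra. Qed.

Lemma dot_self_pos x : x <> zero -> 0 < dot x x.
Proof.
intros H; destruct (Rle_lt_or_eq_dec _ _ (dot_pos x)) as [|E]; auto.
elim H; apply dot_self_0; auto.
Qed.

Lemma dot_self_1 x : dot x x = 1 -> x <> zero.
Proof. intros H ->; revert H; vunfold; lra. Qed.

Lemma dist_sqr x y : dist x y * dist x y = dot (vsub x y) (vsub x y).
Proof. apply sqrt_sqrt, dot_pos. Qed.

Lemma dist_ge0 x y : 0 <= dist x y.
Proof. apply sqrt_pos. Qed.

Lemma dist_le_iff x y k : 0 <= k -> dist x y <= k <-> dot (vsub x y) (vsub x y) <= k * k.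
Proof. rewrite <- dist_sqr; pose proof (dist_ge0 x y); split; nra. Qed.

Lemma dist_eq_iff x y k : 0 <= k -> dist x y = k <-> dot (vsub x y) (vsub x y) = k * k.
Proof. rewrite <- dist_sqr; pose proof (dist_ge0 x y); split; nra. Qed.

Lemma le_dist_iff x y k : 0 <= k -> k <= dist x y <-> k * k <= dot (vsub x y) (vsub x y).
Proof. rewrite <- dist_sqr; pose proof (dist_ge0 x y); split; nra. Qed.

(* [excess a d x r = |d|^2 (dist(x, line)^2 - r^2)], which is polynomial in all the data. *)
Definition excess (a d : pt) (r : R) (x : pt) : R :=
  dot (vsub x a) (vsub x a) * dot d d - dot (vsub x a) d * dot (vsub x a) d - r * r * dot d d.

(** Completing the square in [t]. The added square vanishes at the foot of the perpendicular from
    [x], so [excess] is the minimum of the left side over the line. *)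
Lemma sq_dist_on_line (a d x : pt) (r t : R) :
  dot d d * (dot (vsub x (vadd a (vscale t d))) (vsub x (vadd a (vscale t d))) - r * r) =
  excess a d r x + (t * dot d d - dot (vsub x a) d) * (t * dot d d - dot (vsub x a) d).
Proof. unfold excess; vring. Qed.

Lemma foot_param (a d x : pt) : d <> zero ->
  dot (vsub x a) d / dot d d * dot d d = dot (vsub x a) d.
Proof. intros Hd; apply dot_self_pos in Hd; field; lra. Qed.

Lemma excess_le_dist (a d x : pt) (r t : R) : d <> zero ->
  excess a d r x <= dot d d * (dot (vsub x (vadd a (vscale t d))) (vsub x (vadd a (vscale t d))) - r * r).
Proof.
intros Hd; rewrite sq_dist_on_line.
pose proof (Rle_0_sqr (t * dot d d - dot (vsub x a) d)); unfold Rsqr in *; lra.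
Qed.

Lemma excess_foot (a d x : pt) (r : R) : d <> zero ->
  exists y, on_line a d y /\ dot d d * (dot (vsub x y) (vsub x y) - r * r) = excess a d r x.
Proof.
intros Hd; eexists; split; [exists (dot (vsub x a) d / dot d d); reflexivity|].
rewrite sq_dist_on_line, foot_param; auto; ring.
Qed.

Lemma dist_line_le_iff (a d x : pt) (r : R) : d <> zero -> 0 < r ->
  dist_line_le a d x r <-> excess a d r x <= 0.
Proof.
intros Hd Hr; pose proof (dot_self_pos _ Hd) as Hdd; split.
- intros (y & (t & ->) & H); apply dist_le_iff in H; [|lra].
  apply Rle_trans with (1 := excess_le_dist a d x r t Hd).
  apply Rmult_le_reg_l with (/ dot d d); [apply Rinv_0_lt_compat; auto|].
  rewrite <- Rmult_assoc, Rinv_l; lra.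
- intros H; destruct (excess_foot a d x r Hd) as (y & Hy & E); exists y; split; auto.
  apply dist_le_iff; [lra|].
  apply Rnot_lt_le; intros Hlt.
  assert (0 < dot d d * (dot (vsub x y) (vsub x y) - r * r)) by (apply Rmult_lt_0_compat; lra); lra.
Qed.

Lemma dist_line_eq_iff (a d x : pt) (r : R) : d <> zero -> 0 < r ->
  dist_line_eq a d x r <-> excess a d r x = 0.
Proof.
intros Hd Hr; pose proof (dot_self_pos _ Hd) as Hdd.
destruct (excess_foot a d x r Hd) as (y & Hy & E); split.
- intros ((z & Hz & H) & Hmin); apply Rle_antisym.
  + apply dist_line_le_iff; auto; exists z; split; auto; lra.
  + specialize (Hmin _ Hy); apply le_dist_iff in Hmin; [|lra].
    rewrite <- E; apply Rmult_le_pos; lra.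
- intros H; split.
  + exists y; split; auto; apply dist_eq_iff; [lra|].
    rewrite H in E; apply Rmult_integral in E; lra.
  + intros z (t & ->); apply le_dist_iff; [lra|].
    pose proof (excess_le_dist a d x r t Hd) as L; rewrite H in L.
    apply Rnot_lt_le; intros Hlt.
    match goal with _ : ?u < _ |- _ =>
      assert (0 < dot d d * (r * r - u)) by (apply Rmult_lt_0_compat; lra) end; lra.
Qed.

(** [L] is the squared distance of [p] and [q] after projection along the axis, and each factor
    gives a case. If [L = 0], the axis is parallel to [pq]: (a). If [<e, d> = 0], the points of the
    axis are equidistant from [p] and [q], and [|e|^2 = L <= 4 r^2]: (c). If [L = 4 r^2], the two
    radii are opposite and the axis passes through the midpoint: (b) when [|e| > 2 r]; otherwise
    [|e|^2 <= L] forces [<e, d> = 0], hence (c). *)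
Lemma special_pair (a d p q : pt) (r : R) : 0 < r -> dot d d = 1 -> p <> q ->
  excess a d r p = 0 -> excess a d r q = 0 ->
  let e := vsub q p in let L := dot e e - dot e d * dot e d in
  L * (4 * r * r - L) * dot e d = 0 ->
  cond_a p q a d r \/ cond_b p q a d r \/ cond_c p q a d r.
Proof.
intros Hr Hd Hpq Hp Hq e L H.
assert (Hd0 := dot_self_1 _ Hd).
(* [x1] and [x2] are the radii from the axis to [p] and [q], both of length [r]. *)
pose (x1 := vsub (vsub p a) (vscale (dot (vsub p a) d) d)).
pose (x2 := vsub (vsub q a) (vscale (dot (vsub q a) d) d)).
assert (N : forall y, excess a d r y = 0 ->
  dot (vsub (vsub y a) (vscale (dot (vsub y a) d) d)) (vsub (vsub y a) (vscale (dot (vsub y a) d) d)) = r * r).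
{ intros y; unfold excess; generalize (vsub y a); intros Y E; dexp.
  rewrite Hd in *; rewrite (dot_sym d); lra. }
assert (N1 : dot x1 x1 = r * r) by (apply N; auto).
assert (N2 : dot x2 x2 = r * r) by (apply N; auto).
clear N.
assert (HL : dot (vsub x2 x1) (vsub x2 x1) = L).
{ replace (vsub x2 x1) with (vsub e (vscale (dot e d) d)).
  - unfold L; dexp; rewrite Hd, (dot_sym d e); ring.
  - unfold e, x1, x2; apply pt_ext; vring. }
(* Parallelogram law. Its non-negativity bounds [L] by [4 r^2] in (c); its vanishing says
   [x2 = - x1], which gives the midpoint in (b). *)
assert (Hpar : dot (vadd x2 x1) (vadd x2 x1) = 4 * r * r - L).
{ rewrite <- HL; dexp; rewrite (dot_sym x1 x2), N1, N2; ring. }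
assert (Hc : dot e d = 0 -> cond_c p q a d r).
{ intros E; split; [|split; [|split]].
  - apply dist_le_iff; [lra|].
    replace (dot (vsub p q) (vsub p q)) with L.
    + pose proof (dot_pos (vadd x2 x1)); nra.
    + unfold L; rewrite E; unfold e; vring.
  - apply dist_line_eq_iff; auto.
  - apply dist_line_eq_iff; auto.
  - intros x (t & ->); unfold dist, norm; f_equal.
    assert (X : forall y, dot (vsub (vadd a (vscale t d)) y) (vsub (vadd a (vscale t d)) y) =
       excess a d r y + r * r + (t - dot (vsub y a) d) * (t - dot (vsub y a) d)).
    { intros y; pose proof (sq_dist_on_line a d y r t) as Y; rewrite Hd in Y.
      transitivity (dot (vsub y (vadd a (vscale t d))) (vsub y (vadd a (vscale t d)))); [vring|].
      lra. }
    rewrite !X, Hp, Hq.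
    replace (dot (vsub q a) d) with (dot (vsub p a) d + dot e d) by (unfold e; vring).
    rewrite E; ring. }
apply Rmult_integral in H; destruct H as [H|H]; [|right; right; auto].
apply Rmult_integral in H; destruct H as [H|H].
- left.
  assert (He : e = vscale (dot e d) d).
  { assert (Z : dot (vsub e (vscale (dot e d) d)) (vsub e (vscale (dot e d) d)) = 0).
    { dexp; rewrite Hd, (dot_sym d e); unfold L in H; lra. }
    apply dot_self_0 in Z; revert Z; generalize (dot e d); intros k.
    destruct e as [[? ?] ?], d as [[? ?] ?]; vunfold.
    intros Z; injection Z; intros; repeat f_equal; lra. }
  assert (Hk : dot e d <> 0).
  { intros Z; apply Hpq; rewrite Z in He; unfold e in He; revert He.
    destruct p as [[? ?] ?], q as [[? ?] ?], d as [[? ?] ?]; vunfold.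
    intros Y; injection Y; intros; repeat f_equal; lra. }
  split.
  + exists (/ dot e d); fold e; rewrite He at 2; apply pt_ext; generalize dependent (dot e d);
    intros k; vring; field; auto.
  + apply dist_line_eq_iff; auto.
    * intros Z; apply Hk; fold e in Z; rewrite Z; vring.
    * fold e; rewrite He; generalize (dot e d); intros k.
      transitivity (k * k * excess a d r p); [unfold excess; vring|rewrite Hp; ring].
- destruct (Rle_or_lt (dist p q) (2 * r)) as [Hle|Hlt].
  + right; right; apply Hc; apply dist_le_iff in Hle; [|lra].
    assert (dot e e = dot (vsub p q) (vsub p q)) by (unfold e; vring).
    unfold L in H; clear - H Hle H0.
    assert (Z : dot e d * dot e d <= 0) by lra.
    clear -Z; nra.
  + right; left; split; [auto|split; [|split; apply dist_line_eq_iff; auto]].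
    rewrite H in Hpar; apply dot_self_0 in Hpar.
    exists ((dot (vsub p a) d + dot (vsub q a) d) / 2).
    revert Hpar; unfold x1, x2; generalize (dot (vsub p a) d) (dot (vsub q a) d); intros k l.
    destruct p as [[? ?] ?], q as [[? ?] ?], d as [[? ?] ?], a as [[? ?] ?]; vunfold.
    clear; intros Y; injection Y; intros; apply pt_ext; vunfold; lra.
Qed.

(** * Motions and first contact *)

Lemma continuity_pt_eps (g : R -> R) (x e : R) : continuity_pt g x -> 0 < e ->
  exists d, 0 < d /\ forall y, Rabs (y - x) < d -> Rabs (g y - g x) < e.
Proof.
intros H He; apply continuity_pt_locally with (eps := mkposreal e He) in H.
destruct H as [d Hd]; exists d; split; [apply cond_pos|]; intros y Hy; apply (Hd y Hy).
Qed.

Lemma cp_plus f g x : continuity_pt f x -> continuity_pt g x -> continuity_pt (fun t => f t + g t) x.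
Proof. apply continuity_pt_plus. Qed.
Lemma cp_minus f g x : continuity_pt f x -> continuity_pt g x -> continuity_pt (fun t => f t - g t) x.
Proof. apply continuity_pt_minus. Qed.
Lemma cp_opp f x : continuity_pt f x -> continuity_pt (fun t => - f t) x.
Proof. apply continuity_pt_opp. Qed.
Lemma cp_mult f g x : continuity_pt f x -> continuity_pt g x -> continuity_pt (fun t => f t * g t) x.
Proof. apply continuity_pt_mult. Qed.
Lemma cp_const c x : continuity_pt (fun _ => c) x.
Proof. apply continuity_pt_const; intros ? ?; auto. Qed.
Lemma cp_comp f g x : continuity_pt f x -> continuity_pt g (f x) -> continuity_pt (fun t => g (f t)) x.
Proof. apply continuity_pt_comp. Qed.
Lemma cp_id x : continuity_pt (fun t => t) x.
Proof. apply continuity_pt_id. Qed.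
Lemma cp_sqrt x : continuity_pt sqrt x.
Proof. apply continuity_pt_filterlim, continuous_sqrt. Qed.

Ltac cont := repeat first
  [ assumption | apply cp_const | apply cp_id | apply cp_plus | apply cp_minus | apply cp_mult | apply cp_opp
  | apply continuity_sin | apply continuity_cos | apply cp_sqrt
  | apply (cp_comp _ sin) | apply (cp_comp _ cos) | apply (cp_comp _ sqrt) | solve [auto] ].

(** [T] is the supremum of the times up to which [g <= 0]. The last conjunct records that [g] does
    become positive afterwards, so that a function that is identically zero causes no stop. *)
Lemma first_exit_one (g : R -> R) (T0 : R) :
  (forall t, continuity_pt g t) -> 0 <= T0 -> g 0 <= 0 ->
  (forall t, 0 <= t <= T0 -> g t <= 0) \/
  exists T, 0 <= T <= T0 /\ (forall t, 0 <= t <= T -> g t <= 0) /\ g T = 0 /\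
    exists t, 0 <= t <= T0 /\ 0 < g t.
Proof.
intros Hc H0 Hg0.
destruct (classic (exists t, 0 <= t <= T0 /\ 0 < g t)) as [(t1 & Ht1 & Hg1)|N]; [right|left].
2:{ intros t Ht; apply Rnot_lt_le; intros L; apply N; eauto. }
pose (E t := 0 <= t <= t1 /\ forall s, 0 <= s <= t -> g s <= 0).
destruct (completeness E) as [T HT].
{ exists t1; intros t [Ht _]; lra. }
{ exists 0; split; [lra|]; intros s Hs; replace s with 0 by lra; auto. }
assert (HT0 : 0 <= T).
{ apply HT; split; [lra|]; intros s Hs; replace s with 0 by lra; auto. }
assert (HT1 : T <= t1) by (apply HT; intros t [Ht _]; lra).
assert (below : forall s, 0 <= s < T -> g s <= 0).
{ intros s Hs; apply NNPP; intros N.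
  assert (T <= s); [|lra].
  apply HT; intros t [Ht Hgt]; apply Rnot_lt_le; intros L; apply N, Hgt; lra. }
assert (HgT : g T <= 0).
{ apply Rnot_lt_le; intros L.
  destruct (continuity_pt_eps g T (g T) (Hc T) L) as (e & He & Hd).
  assert (0 < T) by (destruct (Req_dec T 0) as [->|]; lra).
  pose (s := Rmax (T / 2) (T - e / 2)).
  assert (Hs : T / 2 <= s < T /\ T - e / 2 <= s).
  { unfold s; split; [split|]; [apply Rmax_l|apply Rmax_lub_lt; lra|apply Rmax_r]. }
  assert (g s <= 0) by (apply below; lra).
  assert (A : Rabs (g s - g T) < g T) by (apply Hd; apply Rabs_def1; lra).
  apply Rabs_def2 in A; lra. }
assert (HleT : forall s, 0 <= s <= T -> g s <= 0).
{ intros s Hs; destruct (Req_dec s T) as [-> | ]; [auto|apply below; lra]. }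
exists T; split; [lra|split; [auto|split; [|exists t1; split; auto]]].
(* If [g T < 0], continuity keeps [g] negative slightly beyond [T], against the choice of [T]. *)
apply Rle_antisym; auto; apply Rnot_lt_le; intros L.
assert (L' : 0 < - g T) by lra.
destruct (continuity_pt_eps g T (- g T) (Hc T) L') as (e & He & Hd).
assert (T < t1) by (destruct (Req_dec T t1) as [->|]; lra).
pose (s := Rmin t1 (T + e / 2)).
assert (Hs : s <= t1 /\ s <= T + e / 2 /\ T < s).
{ unfold s; split; [apply Rmin_l|split; [apply Rmin_r|apply Rmin_glb_lt; lra]]. }
assert (E s).
{ split; [lra|]; intros u Hu; destruct (Rle_or_lt u T); [apply HleT; lra|].
  assert (A : Rabs (g u - g T) < - g T) by (apply Hd; apply Rabs_def1; lra).
  apply Rabs_def2 in A; lra. }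
assert (s <= T) by (apply HT; auto); lra.
Qed.

(** Induction on the list: the exit time of the head becomes the horizon for the tail, so the stop
    can only move earlier. *)
Lemma first_exit (g : pt -> R -> R) (P : list pt) :
  (forall x t, continuity_pt (g x) t) -> forall T0, 0 <= T0 ->
  (forall x, In x P -> g x 0 <= 0) ->
  (forall x, In x P -> forall t, 0 <= t <= T0 -> g x t <= 0) \/
  exists T, 0 <= T <= T0 /\ (forall x, In x P -> forall t, 0 <= t <= T -> g x t <= 0) /\
    exists x, In x P /\ g x T = 0 /\ exists t, 0 <= t <= T0 /\ 0 < g x t.
Proof.
intros Hc; induction P as [|y l IH]; intros T0 H0 Hs.
{ left; intros x []. }
destruct (first_exit_one (g y) T0 (Hc y) H0) as [Hy|(T1 & HT1 & Hy & Hy0 & t1 & Ht1 & Hgt1)].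
{ apply Hs; left; auto. }
- destruct (IH T0 H0) as [Hl|(T & HT & Hl & x & Hx & Hx0 & t & Ht & Hgt)].
  + intros x Hx; apply Hs; right; auto.
  + left; intros x [<-|Hx]; auto.
  + right; exists T; split; auto; split.
    * intros z [<-|Hz] s Hs'; [apply Hy; lra|apply Hl; auto].
    * exists x; split; [right; auto|split; auto]; exists t; auto.
- destruct (IH T1 (proj1 HT1)) as [Hl|(T & HT & Hl & x & Hx & Hx0 & t & Ht & Hgt)].
  + intros x Hx; apply Hs; right; auto.
  + right; exists T1; split; auto; split.
    * intros x [<-|Hx]; auto.
    * exists y; split; [left; auto|split; auto]; exists t1; auto.
  + right; exists T; split; [lra|split].
    * intros z [<-|Hz] s Hs'; [apply Hy; lra|apply Hl; auto].
    * exists x; split; [right; auto|split; auto]; exists t; split; [lra|auto].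
Qed.

Definition cont_pt (f : R -> pt) : Prop := forall t,
  continuity_pt (fun s => px (f s)) t /\ continuity_pt (fun s => py (f s)) t /\
  continuity_pt (fun s => pz (f s)) t.

Lemma motion_intro (P : list pt) (r : R) (A D : R -> pt) :
  cont_pt A -> cont_pt D ->
  (forall t, 0 <= t <= 1 -> D t <> zero /\ enclosed P (A t) (D t) r) ->
  motion P r (A 0) (D 0) (A 1) (D 1).
Proof.
intros HA HD H; exists A, D; repeat split; auto; try apply HA; try apply HD; apply H; auto.
Qed.

Lemma motion_end (P : list pt) (r : R) (a0 d0 a1 d1 : pt) : motion P r a0 d0 a1 d1 ->
  d1 <> zero /\ enclosed P a1 d1 r.
Proof. intros (A & D & _ & _ & _ & <- & <- & H); apply H; lra. Qed.

Lemma continuity_pt_glue (f g : R -> R) : f 1 = g 0 ->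
  (forall t, continuity_pt f t) -> (forall t, continuity_pt g t) ->
  forall t, continuity_pt (fun s => if Rle_dec s (/ 2) then f (2 * s) else g (2 * s - 1)) t.
Proof.
intros E Hf Hg t.
(* Clamping both arguments at the junction makes one of the two terms equal to [f 1 = g 0] on each
   side, so the case distinction becomes a sum of continuous functions. *)
apply (continuity_pt_ext (fun s => f (2 * Rmin s (/2)) + g (2 * Rmax s (/2) - 1) - f 1)).
- intros s; destruct (Rle_dec s (/2)).
  + rewrite Rmin_left, Rmax_right by lra; replace (2 * / 2 - 1) with 0 by field; lra.
  + rewrite Rmin_right, Rmax_left by lra; replace (2 * / 2) with 1 by field; lra.
- assert (Hmin : forall s, continuity_pt (fun s => Rmin s (/2)) s).
  { intros s; apply (continuity_pt_ext (fun s => (s + /2 - Rabs (s - /2)) * /2)).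
    - intros u; unfold Rmin, Rabs; destruct (Rle_dec u (/2)), (Rcase_abs (u - /2)); lra.
    - cont; apply (cp_comp _ Rabs); [cont|apply Rcontinuity_abs]. }
  assert (Hmax : forall s, continuity_pt (fun s => Rmax s (/2)) s).
  { intros s; apply (continuity_pt_ext (fun s => (s + /2 + Rabs (s - /2)) * /2)).
    - intros u; unfold Rmax, Rabs; destruct (Rle_dec u (/2)), (Rcase_abs (u - /2)); lra.
    - cont; apply (cp_comp _ Rabs); [cont|apply Rcontinuity_abs]. }
  cont.
  + apply (cp_comp (fun s => 2 * Rmin s (/2)) f); cont.
  + apply (cp_comp (fun s => 2 * Rmax s (/2) - 1) g); cont.
Qed.

Lemma motion_trans (P : list pt) (r : R) (a0 d0 a1 d1 a2 d2 : pt) :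
  motion P r a0 d0 a1 d1 -> motion P r a1 d1 a2 d2 -> motion P r a0 d0 a2 d2.
Proof.
intros (A & D & HC & <- & <- & HA1 & HD1 & H) (A' & D' & HC' & <- & <- & <- & <- & H').
pose (G (f f' : R -> pt) := fun t => if Rle_dec t (/2) then f (2 * t) else f' (2 * t - 1)).
assert (G0 : forall f f', G f f' 0 = f 0).
{ intros; unfold G; destruct (Rle_dec 0 (/2)); [f_equal; ring|lra]. }
assert (G1 : forall f f', G f f' 1 = f' 1).
{ intros; unfold G; destruct (Rle_dec 1 (/2)); [lra|f_equal; ring]. }
assert (GC : forall (c : pt -> R) f f', f 1 = f' 0 -> (forall t, continuity_pt (fun s => c (f s)) t) ->
   (forall t, continuity_pt (fun s => c (f' s)) t) -> forall t, continuity_pt (fun s => c (G f f' s)) t).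
{ intros c f f' E Hf Hf' t.
  apply (continuity_pt_ext (fun s => if Rle_dec s (/ 2) then c (f (2 * s)) else c (f' (2 * s - 1)))).
  - intros s; unfold G; destruct (Rle_dec s (/2)); auto.
  - apply (continuity_pt_glue (fun s => c (f s)) (fun s => c (f' s))); auto; f_equal; auto. }
exists (G A A'), (G D D'); split.
- intros t; repeat split; apply GC; auto; intros s; first [apply HC|apply HC'].
- rewrite !G0, !G1; repeat split; auto.
  + unfold G; destruct (Rle_dec t (/2)); [apply H|apply H']; lra.
  + unfold G; destruct (Rle_dec t (/2)); [apply H|apply H']; lra.
Qed.

Lemma cont_pt_rescale (f : R -> pt) (k : R) : cont_pt f -> cont_pt (fun t => f (k * t)).
Proof.
intros H t; repeat split;
[apply (cp_comp (fun t => k * t) (fun s => px (f s)))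
|apply (cp_comp (fun t => k * t) (fun s => py (f s)))
|apply (cp_comp (fun t => k * t) (fun s => pz (f s)))]; cont; apply H.
Qed.

Lemma excess_cont (A D : R -> pt) (r : R) (x : pt) : cont_pt A -> cont_pt D ->
  forall t, continuity_pt (fun t => excess (A t) (D t) r x) t.
Proof.
intros HA HD t; unfold excess, dot, vsub, px, py, pz, mkpt; simpl.
destruct (HA t) as (?&?&?), (HD t) as (?&?&?); unfold px, py, pz in *; cont.
Qed.

Lemma motion_until (P : list pt) (r T : R) (A D : R -> pt) : 0 < r -> 0 <= T <= 1 ->
  cont_pt A -> cont_pt D -> (forall t, 0 <= t <= 1 -> D t <> zero) ->
  (forall x, In x P -> forall t, 0 <= t <= T -> excess (A t) (D t) r x <= 0) ->
  motion P r (A 0) (D 0) (A T) (D T).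
Proof.
intros Hr HT HA HD Hn H.
replace (A 0) with (A (T * 0)) by (f_equal; ring).
replace (D 0) with (D (T * 0)) by (f_equal; ring).
replace (A T) with (A (T * 1)) by (f_equal; ring).
replace (D T) with (D (T * 1)) by (f_equal; ring).
apply (motion_intro P r (fun t => A (T * t)) (fun t => D (T * t)));
  try (apply cont_pt_rescale; auto).
intros t Ht; assert (0 <= T * t <= T) by nra.
split; [apply Hn; lra|]; intros x Hx; apply dist_line_le_iff; auto; apply Hn; lra.
Qed.

(* A continuous family of lines either encloses [P] throughout or can be stopped when the cylinder
   touches a point of [P] that later leaves it; points that stay on the cylinder all along never
   trigger the stop. *)
Lemma motion_or_contact (P : list pt) (r : R) (A D : R -> pt) : 0 < r ->
  cont_pt A -> cont_pt D -> (forall t, 0 <= t <= 1 -> D t <> zero) ->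
  enclosed P (A 0) (D 0) r ->
  (forall t, 0 <= t <= 1 -> motion P r (A 0) (D 0) (A t) (D t)) \/
  exists T, 0 <= T <= 1 /\ motion P r (A 0) (D 0) (A T) (D T) /\
    exists x, In x P /\ excess (A T) (D T) r x = 0 /\
      exists t, 0 <= t <= 1 /\ 0 < excess (A t) (D t) r x.
Proof.
intros Hr HA HD Hn H.
destruct (first_exit (fun x t => excess (A t) (D t) r x) P) with (T0 := 1)
  as [Hall|(T & HT & Hall & Hx)]; try lra.
- intros x; apply excess_cont; auto.
- intros x Hx; apply dist_line_le_iff; auto; apply Hn; lra.
- left; intros t Ht; apply motion_until; auto; intros x Hx s Hs; apply Hall; auto; lra.
- right; exists T; split; auto; split; auto; apply motion_until; auto.
Qed.

Lemma enclosed_same_line (P : list pt) (a d : pt) (r t k : R) : k <> 0 ->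
  enclosed P a d r -> enclosed P (vadd a (vscale t d)) (vscale k d) r.
Proof.
intros Hk H x Hx; destruct (H x Hx) as (y & (s & ->) & Hd).
exists (vadd a (vscale s d)); split; auto; exists ((s - t) / k).
apply pt_ext; vring; field; auto.
Qed.

(** The line stays fixed as a set; only its base point and direction vector change. Since [k > 0],
    the factor [1 - s + s * k] never vanishes. *)
Lemma motion_same_line (P : list pt) (a d : pt) (r t k : R) : 0 < k -> d <> zero ->
  enclosed P a d r -> motion P r a d (vadd a (vscale t d)) (vscale k d).
Proof.
intros Hk Hd H.
assert (M := motion_intro P r (fun s => vadd a (vscale (s * t) d))
  (fun s => vscale (1 - s + s * k) d)); simpl in M.
replace (vadd a (vscale (0 * t) d)) with a in M by (apply pt_ext; vring).
replace (vadd a (vscale (1 * t) d)) with (vadd a (vscale t d)) in M by (rewrite Rmult_1_l; auto).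
replace (vscale (1 - 0 + 0 * k) d) with d in M by (apply pt_ext; vring).
replace (vscale (1 - 1 + 1 * k) d) with (vscale k d) in M by (f_equal; ring).
apply M.
- intros s; repeat split; vunfold; cont.
- intros s; repeat split; vunfold; cont.
- intros s Hs; assert (0 < 1 - s + s * k) by nra; split.
  + intros E; apply Hd; apply dot_self_0.
    assert (Z : dot (vscale (1 - s + s * k) d) (vscale (1 - s + s * k) d) = 0) by (rewrite E; vring).
    revert Z; dexp; intros Z; apply Rmult_integral in Z; destruct Z as [|Z]; [lra|].
    apply Rmult_integral in Z; destruct Z; [lra|auto].
  + apply enclosed_same_line; auto; lra.
Qed.

(** * Following an implicit curve *)

Definition lipschitz (K : R) (Y : R -> R) : Prop := forall s t, Rabs (Y s - Y t) <= K * Rabs (s - t).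

Lemma lipschitz_cont (K : R) (Y : R -> R) : 0 < K -> lipschitz K Y -> forall t, continuity_pt Y t.
Proof.
intros HK H t; apply continuity_pt_locally; intros [e He].
assert (Hd : 0 < e / K) by (apply Rdiv_lt_0_compat; auto).
exists (mkposreal _ Hd); intros y Hy; simpl in *; change (Rabs (y - t) < e / K) in Hy.
apply Rle_lt_trans with (1 := H y t).
apply Rmult_lt_compat_l with (r := K) in Hy; auto; replace (K * (e / K)) with e in Hy; auto; field; lra.
Qed.

(** McShane's extension theorem, with the partial function given as a relation: [Y t] is the
    supremum of [v - K |t - s|] over all [(s, v)] in [V]. *)
Lemma mcshane (K : R) (V : R -> R -> Prop) : 0 <= K -> (exists s v, V s v) ->
  (forall s v s' v', V s v -> V s' v' -> Rabs (v - v') <= K * Rabs (s - s')) ->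
  exists Y, lipschitz K Y /\ forall s v, V s v -> Y s = v.
Proof.
intros HK (s0 & v0 & H0) HV.
pose (E t w := exists s v, V s v /\ w = v - K * Rabs (t - s)).
assert (tri : forall a b c, K * Rabs (a - b) <= K * Rabs (a - c) + K * Rabs (b - c)).
{ intros a b c; rewrite <- Rmult_plus_distr_l; apply Rmult_le_compat_l; auto.
  rewrite (Rabs_minus_sym b c); replace (a - b) with ((a - c) + (c - b)) by ring; apply Rabs_triang. }
assert (bd : forall t s v, V s v -> is_upper_bound (E t) (v + K * Rabs (t - s))).
{ intros t s v Hv w (s' & v' & Hv' & ->).
  specialize (HV _ _ _ _ Hv' Hv); pose proof (tri s' s t) as Q.
  pose proof (Rle_abs (v' - v)); rewrite (Rabs_minus_sym s' t), (Rabs_minus_sym s t) in Q; lra. }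
assert (sup : forall t, {m | is_lub (E t) m}).
{ intros t; apply completeness; [eexists; apply (bd t _ _ H0)|].
  exists (v0 - K * Rabs (t - s0)), s0, v0; auto. }
exists (fun t => proj1_sig (sup t)); split.
- assert (half : forall s t, proj1_sig (sup s) <= proj1_sig (sup t) + K * Rabs (s - t)).
  { intros s t; destruct (sup s) as [m Hm], (sup t) as [n Hn]; simpl.
    apply Hm; intros w (u & v & Hv & ->).
    assert (v - K * Rabs (t - u) <= n) by (apply Hn; exists u, v; auto).
    pose proof (tri t u s) as Q; rewrite (Rabs_minus_sym t s), (Rabs_minus_sym u s) in Q; lra. }
  intros s t; apply Rabs_le; pose proof (half s t); pose proof (half t s).
  rewrite (Rabs_minus_sym t s) in *; lra.
- intros s v Hv; destruct (sup s) as [m Hm]; simpl; apply Rle_antisym.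
  + apply Hm; pose proof (bd s s v Hv) as B; rewrite Rminus_diag, Rabs_R0, Rmult_0_r, Rplus_0_r in B; auto.
  + apply Hm; exists s, v; split; auto; rewrite Rminus_diag, Rabs_R0; ring.
Qed.

Section Follow.
Variables (A B : R -> R -> Prop) (K x0 X y0 : R).
Hypothesis HK : 0 < K.
Hypothesis HX : x0 <= X.
Hypothesis start : A x0 y0.
Hypothesis closed : forall x y,
  (forall e, 0 < e -> exists x' y', Rabs (x' - x) < e /\ Rabs (y' - y) < e /\ A x' y') -> A x y.
Hypothesis local : forall x y, x0 <= x < X -> A x y -> ~ B x y ->
  exists d e, 0 < d /\ 0 < e /\
    (forall x', Rabs (x' - x) < d -> exists y', Rabs (y' - y) < e /\ A x' y' /\ ~ B x' y') /\
    (forall x1 y1 x2 y2, Rabs (x1 - x) < d -> Rabs (y1 - y) < e -> Rabs (x2 - x) < d ->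
       Rabs (y2 - y) < e -> A x1 y1 -> A x2 y2 -> Rabs (y1 - y2) <= K * Rabs (x1 - x2)).

(** By [local], [A] is a [K]-Lipschitz graph near each of its points outside [B]. A branch follows
    this graph from [(x0, y0)] up to abscissa [x] and may meet [B] only at its end. [Y] is total and
    Lipschitz everywhere, but only its values on [[x0, x]] matter. *)
Let branch (x : R) (Y : R -> R) : Prop :=
  lipschitz K Y /\ Y x0 = y0 /\ (forall t, x0 <= t <= x -> A t (Y t)) /\
  (forall t, x0 <= t < x -> ~ B t (Y t)).

(** Let [T] be the supremum of the abscissas up to which the branches agree. They agree at [T] by
    continuity, and [T] lies before the end of both, so their common point there is outside [B] and
    [local] forces agreement beyond [T]. *)
Lemma branch_unique (x x' : R) (Y Y' : R -> R) : x <= X -> branch x Y -> branch x' Y' ->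
  forall t, x0 <= t -> t <= x -> t <= x' -> Y t = Y' t.
Proof.
intros Hx (HL & H0 & HA & HB) (HL' & H0' & HA' & HB') t Ht0 Ht Ht'.
apply NNPP; intros N.
pose (E s := x0 <= s <= t /\ forall u, x0 <= u <= s -> Y u = Y' u).
assert (E0 : E x0).
{ split; [lra|]; intros u Hu; replace u with x0 by lra; congruence. }
destruct (completeness E) as [T HT].
{ exists t; intros s [Hs _]; lra. }
{ exists x0; auto. }
assert (HT0 : x0 <= T) by (apply HT; auto).
assert (HTt : T <= t) by (apply HT; intros s [Hs _]; lra).
assert (below : forall s, x0 <= s < T -> Y s = Y' s).
{ intros s Hs; apply NNPP; intros M.
  assert (T <= s); [|lra].
  apply HT; intros u [Hu Hgu]; apply Rnot_lt_le; intros L; apply M, Hgu; lra. }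
assert (ET : Y T = Y' T).
{ apply NNPP; intros M.
  assert (Hne : x0 < T) by (destruct (Req_dec T x0) as [->|]; [elim M; congruence|lra]).
  assert (Hgap : 0 < Rabs (Y T - Y' T)) by (apply Rabs_pos_lt; lra).
  pose (g := Rabs (Y T - Y' T)); fold g in Hgap.
  assert (Hq : 0 < g / (4 * K)) by (apply Rdiv_lt_0_compat; lra).
  pose (s := Rmax x0 (T - g / (4 * K))).
  assert (Hs : x0 <= s < T /\ T - g / (4 * K) <= s).
  { unfold s; split; [split|]; [apply Rmax_l|apply Rmax_lub_lt; lra|apply Rmax_r]. }
  assert (HKs : K * Rabs (T - s) <= g / 4).
  { rewrite Rabs_right by lra; apply Rle_trans with (K * (g / (4 * K))); [|right; field; lra].
    apply Rmult_le_compat_l; lra. }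
  pose proof (HL T s) as A1; pose proof (HL' T s) as A2; rewrite <- (below s (proj1 Hs)) in A2.
  assert (g <= Rabs (Y T - Y s) + Rabs (Y' T - Y s)); [|lra].
  unfold g; rewrite (Rabs_minus_sym (Y' T)).
  replace (Y T - Y' T) with ((Y T - Y s) + (Y s - Y' T)) by ring; apply Rabs_triang. }
assert (Hlt : T < t) by (destruct (Req_dec T t) as [->|]; [contradiction|lra]).
destruct (local T (Y T)) as (d & e & Hd & He & _ & Hu); try (apply HA; lra); try (apply HB; lra); [lra|].
assert (Hq : 0 < e / K) by (apply Rdiv_lt_0_compat; lra).
(* Small enough for both branches to stay in the box of [local] on [[T, T + h]]. *)
pose (h := Rmin (t - T) (Rmin d (e / K)) / 2).
assert (Hh : 0 < h < d /\ h <= t - T /\ K * h < e).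
{ assert (h0 : 0 < Rmin (t - T) (Rmin d (e / K))) by (repeat apply Rmin_glb_lt; lra).
  pose proof (Rmin_l (t - T) (Rmin d (e / K))); pose proof (Rmin_r (t - T) (Rmin d (e / K))).
  pose proof (Rmin_l d (e / K)); pose proof (Rmin_r d (e / K)).
  repeat split; unfold h; try lra.
  apply Rlt_le_trans with (K * (e / K)); [|right; field; lra].
  apply Rmult_lt_compat_l; lra. }
assert (In : E (T + h)); [|apply HT in In; lra].
split; [lra|]; intros u Huu.
destruct (Rle_or_lt T u) as [HTu|HTu]; [|apply below; lra].
assert (Z : K * Rabs (u - T) < e).
{ rewrite Rabs_right by lra; apply Rle_lt_trans with (K * h); [|lra]; apply Rmult_le_compat_l; lra. }
(* The Lipschitz bound of [local] at two points with the same abscissa is zero. *)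
assert (W : Rabs (Y u - Y' u) <= K * Rabs (u - u)).
{ apply Hu; try (apply HA; lra); try (apply HA'; lra); try (rewrite Rabs_right; lra).
  - apply Rle_lt_trans with (1 := HL u T); auto.
  - rewrite ET; apply Rle_lt_trans with (1 := HL' u T); auto. }
rewrite Rminus_diag, Rabs_R0, Rmult_0_r in W.
pose proof (Rabs_pos (Y u - Y' u)); apply Rminus_diag_uniq.
destruct (Req_dec (Y u - Y' u) 0); auto; apply Rabs_pos_lt in H1; lra.
Qed.

(** The part of [A] in the box around [(x, Y x)] is a Lipschitz relation; its extension [Z] takes
    over from [Y] after [x]. *)
Lemma branch_extend (x : R) (Y : R -> R) : x0 <= x < X -> branch x Y -> ~ B x (Y x) ->
  exists h Y', 0 < h /\ x + h <= X /\ branch (x + h) Y'.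
Proof.
intros Hx (HL & H0 & HA & HB) HBx.
destruct (local x (Y x)) as (d & e & Hd & He & Hex & Hu); auto; [apply HA; lra|].
destruct (mcshane K (fun t v => Rabs (t - x) < d /\ Rabs (v - Y x) < e /\ A t v)) as (Z & HZ & HZv).
- lra.
- exists x, (Y x); rewrite !Rminus_diag, Rabs_R0; repeat split; auto; apply HA; lra.
- intros s v s' v' (?&?&?) (?&?&?); apply Hu; auto.
- assert (HZx : Z x = Y x).
  { apply HZv; rewrite !Rminus_diag, Rabs_R0; repeat split; auto; apply HA; lra. }
  assert (HZA : forall t, Rabs (t - x) < d -> A t (Z t) /\ ~ B t (Z t)).
  { intros t Ht; destruct (Hex t Ht) as (y & Hy1 & Hy2 & Hy3).
    rewrite (HZv t y) by auto; auto. }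
  pose (h := Rmin (X - x) d / 2).
  assert (Hh : 0 < h < d /\ h <= X - x).
  { assert (0 < Rmin (X - x) d) by (apply Rmin_glb_lt; lra).
    pose proof (Rmin_l (X - x) d); pose proof (Rmin_r (X - x) d); unfold h; lra. }
  exists h, (fun t => if Rle_dec t x then Y t else Z t); split; [lra|split; [lra|]].
  split; [|split; [|split]].
  + intros s t.
    assert (mix : forall s t, s <= x -> x <= t -> Rabs (Y s - Z t) <= K * Rabs (s - t)).
    { clear s t; intros s t Hs Ht.
      replace (Y s - Z t) with ((Y s - Y x) + (Z x - Z t)) by (rewrite HZx; ring).
      apply Rle_trans with (1 := Rabs_triang _ _).
      pose proof (HL s x) as L1; pose proof (HZ x t) as L2.
      rewrite Rabs_left1 with (a := s - x) in L1 by lra.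
      rewrite Rabs_left1 with (a := x - t) in L2 by lra.
      rewrite (Rabs_left1 (s - t)) by lra; lra. }
    destruct (Rle_dec s x), (Rle_dec t x); auto.
    * apply mix; lra.
    * rewrite Rabs_minus_sym, (Rabs_minus_sym s); apply mix; lra.
  + destruct (Rle_dec x0 x); [auto|lra].
  + intros t Ht; destruct (Rle_dec t x); [apply HA; lra|].
    apply HZA; rewrite Rabs_right; lra.
  + intros t Ht; destruct (Rle_dec t x).
    * destruct (Req_dec t x) as [->|]; auto; apply HB; lra.
    * apply HZA; rewrite Rabs_right; lra.
Qed.

(* Branches agree where both are defined, so their union is a Lipschitz function, which extends to the
   supremum of the domains. *)
Lemma follow_branch : exists x Y, x0 <= x <= X /\ lipschitz K Y /\ Y x0 = y0 /\
  (forall t, x0 <= t <= x -> A t (Y t)) /\ (x = X \/ B x (Y x)).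
Proof.
pose (E x := x0 <= x <= X /\ exists Y, branch x Y).
assert (E0 : E x0).
{ split; [lra|]; exists (fun _ => y0); repeat split; auto.
  - intros s t; rewrite Rminus_diag, Rabs_R0; apply Rmult_le_pos; [lra|apply Rabs_pos].
  - intros t Ht; replace t with x0 by lra; auto.
  - intros t Ht; lra. }
destruct (completeness E) as [T HT].
{ exists X; intros s [Hs _]; lra. }
{ exists x0; auto. }
assert (HT0 : x0 <= T) by (apply HT; auto).
assert (HTX : T <= X) by (apply HT; intros s [Hs _]; lra).
destruct (mcshane K (fun s v => exists x Y, x <= X /\ branch x Y /\ x0 <= s <= x /\ v = Y s)) as (Y & HL & HV).
- lra.
- destruct E0 as [_ [Y HY]]; exists x0, (Y x0), x0, Y; repeat split; auto; try lra; apply HY.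
- intros s v s' v' (x & Y & Hx & HY & Hs & ->) (x' & Y' & Hx' & HY' & Hs' & ->).
  destruct (Rle_or_lt s' x).
  + rewrite <- (branch_unique x x' Y Y') by (auto; lra); apply HY.
  + rewrite (branch_unique x x' Y Y') by (auto; lra); apply HY'.
- assert (below : forall t, x0 <= t < T -> exists x Z, t < x /\ x <= X /\ branch x Z).
  { intros t Ht; apply NNPP; intros M; assert (T <= t); [|lra].
    apply HT; intros x [Hx [Z HZ]]; apply Rnot_lt_le; intros L; apply M; exists x, Z; split; [lra|split; [lra|auto]]. }
  assert (HY0 : Y x0 = y0).
  { destruct E0 as [_ [Z HZ]]; apply HV; exists x0, Z; repeat split; try apply HZ; try lra.
    symmetry; apply HZ. }
  assert (HAB : forall t, x0 <= t < T -> A t (Y t) /\ ~ B t (Y t)).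
  { intros t Ht; destruct (below t Ht) as (x & Z & Hx & HxX & HZ).
    rewrite (HV t (Z t)) by (exists x, Z; repeat split; auto; lra || apply HZ).
    split; apply HZ; lra. }
  assert (HAT : A T (Y T)).
  { apply closed; intros e He.
    destruct (Req_dec T x0) as [->|]; [exists x0, y0; rewrite HY0, !Rminus_diag, Rabs_R0; auto|].
    (* With [|t - T| < e / (K + 1)], both [|t - T|] and [K |t - T|] are below [e], so points of [A]
       on the branch approach [(T, Y T)]. *)
    assert (Hq : 0 < e / (K + 1)) by (apply Rdiv_lt_0_compat; lra).
    assert (Hm : 0 < Rmin (e / (K + 1)) (T - x0)) by (apply Rmin_glb_lt; lra).
    pose proof (Rmin_l (e / (K + 1)) (T - x0)); pose proof (Rmin_r (e / (K + 1)) (T - x0)).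
    pose (t := T - Rmin (e / (K + 1)) (T - x0) / 2).
    assert (HR : Rabs (t - T) < e / (K + 1)) by (unfold t; apply Rabs_def1; lra).
    assert (Hm' : (K + 1) * Rabs (t - T) < e).
    { apply Rlt_le_trans with ((K + 1) * (e / (K + 1))); [|right; field; lra].
      apply Rmult_lt_compat_l; lra. }
    assert (0 <= K * Rabs (t - T)) by (apply Rmult_le_pos; [lra|apply Rabs_pos]).
    pose proof (Rabs_pos (t - T)).
    exists t, (Y t); split; [lra|split; [|apply HAB; unfold t; lra]].
    apply Rle_lt_trans with (1 := HL t T); lra. }
  assert (HB : branch T Y).
  { split; [auto|split; [auto|split]].
    - intros t Ht; destruct (Req_dec t T) as [->|]; auto; apply HAB; lra.
    - intros t Ht; apply HAB; lra. }
  exists T, Y; split; [lra|split; [auto|split; [auto|split; [apply HB|]]]].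
  destruct (Req_dec T X) as [|NX]; [auto|right]; apply NNPP; intros NB.
  destruct (branch_extend T Y) as (h & Z & Hh & HhX & HZ); auto; [lra|].
  assert (T + h <= T); [|lra].
  apply HT; split; [lra|]; exists Z; auto.
Qed.

End Follow.

(** * Implicit functions with a slope bound *)

Section Box.
Variables (F Fx Fy : R -> R -> R) (K x0 y0 r0 : R).
Hypothesis Hr0 : 0 < r0.
Hypothesis deriv : forall x y, Rabs (x - x0) < r0 -> Rabs (y - y0) < r0 -> forall i j,
  is_derive (fun t => F (x + i * t) (y + j * t)) 0 (i * Fx x y + j * Fy x y).
Hypothesis slope : forall x y, Rabs (x - x0) < r0 -> Rabs (y - y0) < r0 -> Rabs (Fx x y) < K * Fy x y.
Hypothesis HK : 0 < K.

Lemma box_segment (x1 y1 x2 y2 : R) :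
  Rabs (x1 - x0) < r0 -> Rabs (y1 - y0) < r0 -> Rabs (x2 - x0) < r0 -> Rabs (y2 - y0) < r0 ->
  (forall x y, Rabs (x - x0) < r0 -> Rabs (y - y0) < r0 ->
     0 < (x2 - x1) * Fx x y + (y2 - y1) * Fy x y) ->
  F x1 y1 < F x2 y2.
Proof.
intros Hx1 Hy1 Hx2 Hy2 Hpos.
set (i := x2 - x1) in *; set (j := y2 - y1) in *.
assert (inside : forall t, 0 <= t <= 1 -> Rabs (x1 + i * t - x0) < r0 /\ Rabs (y1 + j * t - y0) < r0).
{ assert (cv : forall a b c t, 0 <= t <= 1 -> Rabs (a - c) < r0 -> Rabs (b - c) < r0 ->
    Rabs (a + (b - a) * t - c) < r0).
  { clear; intros a b c t Ht Ha Hb; apply Rabs_def2 in Ha, Hb.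
    destruct (Rle_or_lt a b); apply Rabs_def1; nra. }
  intros t Ht; split; apply cv; auto. }
assert (D : forall t, 0 <= t <= 1 -> is_derive (fun t => F (x1 + i * t) (y1 + j * t)) t
   (i * Fx (x1 + i * t) (y1 + j * t) + j * Fy (x1 + i * t) (y1 + j * t))).
{ intros t Ht; destruct (inside t Ht) as [I J]; pose proof (deriv _ _ I J i j) as d.
  (* [deriv] gives derivatives at parameter [0] only, so the segment is reparametrized from its
     point at [t]. *)
  apply (is_derive_ext (fun u => F (x1 + i * t + i * (u - t)) (y1 + j * t + j * (u - t)))).
  - intros u; f_equal; ring.
  - replace (i * Fx (x1 + i * t) (y1 + j * t) + j * Fy (x1 + i * t) (y1 + j * t))
      with (scal 1 (i * Fx (x1 + i * t) (y1 + j * t) + j * Fy (x1 + i * t) (y1 + j * t)))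
      by (unfold scal; simpl; unfold mult; simpl; ring).
    apply (is_derive_comp (fun v => F (x1 + i * t + i * v) (y1 + j * t + j * v)) (fun u => u - t)).
    + rewrite Rminus_diag; auto.
    + auto_derive; auto. }
destruct (MVT_gen (fun t => F (x1 + i * t) (y1 + j * t)) 0 1
  (fun t => i * Fx (x1 + i * t) (y1 + j * t) + j * Fy (x1 + i * t) (y1 + j * t))) as (c & Hc & E).
- intros t Ht; rewrite Rmin_left, Rmax_right in Ht by lra; apply D; lra.
- intros t Ht; rewrite Rmin_left, Rmax_right in Ht by lra.
  apply continuity_pt_filterlim, (ex_derive_continuous (fun t => F (x1 + i * t) (y1 + j * t))).
  eexists; apply D; lra.
- rewrite Rmin_left, Rmax_right in Hc by lra.
  destruct (inside c Hc) as [I J]; specialize (Hpos _ _ I J).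
  replace (x1 + i * 1) with x2 in E by (unfold i; ring).
  replace (y1 + j * 1) with y2 in E by (unfold j; ring).
  replace (x1 + i * 0) with x1 in E by ring; replace (y1 + j * 0) with y1 in E by ring; lra.
Qed.

(** In a direction [(i, j)] with [K |i| <= j] and [j > 0], the bound [|Fx| < K Fy] makes
    [i Fx + j Fy] positive throughout the box. *)
Lemma cone_increase (x1 y1 x2 y2 : R) :
  Rabs (x1 - x0) < r0 -> Rabs (y1 - y0) < r0 -> Rabs (x2 - x0) < r0 -> Rabs (y2 - y0) < r0 ->
  K * Rabs (x2 - x1) <= y2 - y1 -> y1 < y2 -> F x1 y1 < F x2 y2.
Proof.
intros Hx1 Hy1 Hx2 Hy2 Hc Hlt; apply box_segment; auto; intros x y Hx Hy.
specialize (slope x y Hx Hy).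
assert (P : 0 < Fy x y).
{ apply Rmult_lt_reg_l with K; auto; pose proof (Rabs_pos (Fx x y)); lra. }
assert (Q : Rabs ((x2 - x1) * Fx x y) < (y2 - y1) * Fy x y \/ x2 - x1 = 0).
{ destruct (Req_dec (x2 - x1) 0); auto; left; rewrite Rabs_mult.
  assert (0 < Rabs (x2 - x1)) by (apply Rabs_pos_lt; auto).
  apply Rlt_le_trans with (Rabs (x2 - x1) * (K * Fy x y)); [apply Rmult_lt_compat_l; auto|].
  rewrite <- Rmult_assoc, (Rmult_comm (Rabs _) K); apply Rmult_le_compat_r; lra. }
destruct Q as [Q | ->].
- apply Rabs_def2 in Q; lra.
- rewrite Rmult_0_l, Rplus_0_l; apply Rmult_lt_0_compat; lra.
Qed.

(** An implicit function theorem with explicit Lipschitz constant. The points [(x, y0 + h)] and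
    [(x, y0 - h)] with [h = K |x - x0|] lie in the upper and lower cones at [(x0, y0)], so [F]
    changes sign between them. Two zeros violating the Lipschitz bound would lie in each other's
    cones, where [F] is strictly monotone. *)
Lemma box_graph : F x0 y0 = 0 -> exists d, 0 < d /\ d <= r0 /\
  (forall x, Rabs (x - x0) < d -> exists y, Rabs (y - y0) < r0 /\ F x y = 0) /\
  (forall x1 y1 x2 y2, Rabs (x1 - x0) < d -> Rabs (y1 - y0) < r0 -> Rabs (x2 - x0) < d ->
     Rabs (y2 - y0) < r0 -> F x1 y1 = 0 -> F x2 y2 = 0 -> Rabs (y1 - y2) <= K * Rabs (x1 - x2)).
Proof.
intros H0.
(* This width ensures both [d <= r0] and [K * d < r0], so the cone points stay in the box. *)
assert (Hd : 0 < r0 / (K + 1)) by (apply Rdiv_lt_0_compat; lra).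
assert (HdK : r0 / (K + 1) * (K + 1) = r0) by (field; lra).
assert (Hdr : r0 / (K + 1) <= r0) by nra.
exists (r0 / (K + 1)); split; [auto|split; [auto|split]].
- intros x Hx.
  assert (Z0 : Rabs (x0 - x0) < r0) by (rewrite Rminus_diag, Rabs_R0; auto).
  assert (Z1 : Rabs (y0 - y0) < r0) by (rewrite Rminus_diag, Rabs_R0; auto).
  destruct (Req_dec x x0) as [->|Hne]; [exists y0; auto|].
  pose (h := K * Rabs (x - x0)).
  assert (Hh : 0 < h < r0).
  { assert (0 < Rabs (x - x0)) by (apply Rabs_pos_lt; lra); unfold h; split; [nra|].
    apply Rmult_lt_compat_l with (r := K) in Hx; auto; nra. }
  assert (up : 0 < F x (y0 + h)).
  { rewrite <- H0; apply cone_increase; auto; try lra; try (apply Rabs_def1; lra); unfold h; lra. }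
  assert (dn : F x (y0 - h) < 0).
  { rewrite <- H0; apply cone_increase; auto; try lra; try (apply Rabs_def1; lra); unfold h.
    rewrite (Rabs_minus_sym x0 x); lra. }
  destruct (IVT_interv (fun y => F x y) (y0 - h) (y0 + h)) as (y & Hy & E); auto; try lra.
  + intros y Hy; apply continuity_pt_filterlim.
    apply (ex_derive_continuous (fun y => F x y)).
    assert (I : Rabs (x - x0) < r0) by lra.
    assert (J : Rabs (y - y0) < r0) by (apply Rabs_def1; lra).
    pose proof (deriv x y I J 0 1) as d.
    exists (scal 1 (0 * Fx x y + 1 * Fy x y)).
    apply (is_derive_ext (fun u => F (x + 0 * (u - y)) (y + 1 * (u - y)))).
    * intros u; f_equal; ring.
    * apply (is_derive_comp (fun v => F (x + 0 * v) (y + 1 * v)) (fun u => u - y)).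
      -- rewrite Rminus_diag; auto.
      -- auto_derive; auto.
  + exists y; split; auto; apply Rabs_def1; lra.
- intros x1 y1 x2 y2 Hx1 Hy1 Hx2 Hy2 E1 E2.
  apply Rabs_le; split; apply Rnot_lt_le; intros L.
  + assert (F x1 y1 < F x2 y2); [|lra].
    pose proof (Rabs_pos (x1 - x2)).
    apply cone_increase; try lra; [rewrite Rabs_minus_sym; lra|nra].
  + assert (F x2 y2 < F x1 y1); [|lra].
    pose proof (Rabs_pos (x1 - x2)).
    apply cone_increase; try lra; nra.
Qed.
End Box.

(** * Common tangents of three spheres *)

Lemma continuity_2d_pos (f : R -> R -> R) (x y : R) : continuity_2d_pt f x y -> 0 < f x y ->
  exists d, 0 < d /\ forall u v, Rabs (u - x) < d -> Rabs (v - y) < d -> 0 < f u v.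
Proof.
intros H Hp; destruct (H (mkposreal _ Hp)) as [d Hd]; exists d; split; [apply cond_pos|].
intros u v Hu Hv; specialize (Hd u v Hu Hv); simpl in Hd; apply Rabs_def2 in Hd; lra.
Qed.

Lemma continuity_2d_limit_le (f : R -> R -> R) (P : R -> R -> Prop) (x y : R) :
  continuity_2d_pt f x y -> (forall u v, P u v -> f u v <= 0) ->
  (forall e, 0 < e -> exists u v, Rabs (u - x) < e /\ Rabs (v - y) < e /\ P u v) -> f x y <= 0.
Proof.
intros H HP Hl; apply Rnot_lt_le; intros L.
destruct (continuity_2d_pos f x y H L) as (d & Hd & Hpos).
destruct (Hl d Hd) as (u & v & Hu & Hv & Huv).
specialize (Hpos u v Hu Hv); specialize (HP u v Huv); lra.
Qed.

Ltac cont2d := repeat first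
  [ apply continuity_2d_pt_const | apply continuity_2d_pt_id1 | apply continuity_2d_pt_id2
  | apply continuity_2d_pt_plus | apply continuity_2d_pt_minus | apply continuity_2d_pt_mult
  | apply continuity_2d_pt_opp
  | apply (continuity_1d_2d_pt_comp sin); [apply continuity_sin|]
  | apply (continuity_1d_2d_pt_comp cos); [apply continuity_cos|]
  | apply (continuity_1d_2d_pt_comp sqrt); [apply cp_sqrt|]
  | apply (continuity_1d_2d_pt_comp Rabs); [apply Rcontinuity_abs|]
  | solve [auto] ].

(* In coordinates centred at the midpoint of [pq] with third axis along [pq], the contacts are
   [(0,0,-m)], [(0,0,m)] and [(x,y,z)]. The line at [(al, ph)] has direction
   [(sin al cos ph, sin al sin ph, cos al)] and passes through [waist al * (- sin ph, cos ph, 0)], its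
   point closest to [pq]; [gap] is the squared distance of [(x,y,z)] from it minus [r^2]. *)
Section Tangents.
Variables (m r x y z : R).
Hypothesis Hm : 0 < m.
Hypothesis Hr : 0 < r.

Definition room (al : R) : R := r * r - m * m * (sin al * sin al).
Definition waist (al : R) : R := sqrt (room al).
Definition rho (ph : R) : R := x * cos ph + y * sin ph.
Definition kap (ph : R) : R := y * cos ph - x * sin ph.
Definition gap (al ph : R) : R :=
  x * x + y * y + z * z - m * m * (sin al * sin al) - 2 * waist al * kap ph
  - (sin al * rho ph + cos al * z) * (sin al * rho ph + cos al * z).
(* [waist] times the partial derivative of [gap] in [al] *)
Definition gap_al (al ph : R) : R :=
  - 2 * (m * m) * (sin al * cos al) * waist al + 2 * (m * m) * (sin al * cos al) * kap ph
  - 2 * waist al * (sin al * rho ph + cos al * z) * (cos al * rho ph - sin al * z).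
Definition gap_ph (al ph : R) : R :=
  2 * waist al * rho ph - 2 * sin al * (sin al * rho ph + cos al * z) * kap ph.
(* Squared length of the projection along the line of the segment from [(0,0,w)] to [(x,y,z)]. *)
Definition pair_len (w al ph : R) : R :=
  (cos al * rho ph - sin al * (z - w)) * (cos al * rho ph - sin al * (z - w)) + kap ph * kap ph.
Definition pair_special (w al ph : R) : R :=
  pair_len w al ph * (4 * r * r - pair_len w al ph) * (sin al * rho ph + cos al * (z - w)).
(* At a common tangent, [special] vanishes iff two of the three contacts are in position (a), (b) or
   (c); see [special_pair]. *)
Definition special (al ph : R) : R :=
  sin al * waist al * cos al * pair_special m al ph * pair_special (- m) al ph.

Ltac gunfold := unfold special, pair_special, pair_len, gap, gap_al, gap_ph, waist, room, rho, kap.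

Lemma waist_sqr (al : R) : 0 <= room al -> waist al * waist al = room al.
Proof. apply sqrt_sqrt. Qed.

Lemma waist_pos (al : R) : 0 < room al -> 0 < waist al.
Proof. apply sqrt_lt_R0. Qed.

Lemma gap_derive (al ph i j : R) : 0 < room al ->
  is_derive (fun t => gap (al + i * t) (ph + j * t)) 0 (i * (gap_al al ph / waist al) + j * gap_ph al ph).
Proof.
intros H; pose proof (waist_pos al H) as Hw; revert H Hw; gunfold; intros H Hw.
auto_derive; rewrite !Rmult_0_r, !Rplus_0_r; [lra|].
unfold Rminus in *; field; lra.
Qed.

(* The derivative of [gap] along the field turning the direction of the line orthogonally to the
   radius at [(0,0,-w)]. *)
Lemma gap_al_ph (al ph w : R) : w * w = m * m ->
  gap_al al ph + w * gap_ph al ph =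
  2 * (sin al * rho ph + cos al * (z - w)) *
  (- waist al * (cos al * rho ph - sin al * z) - w * sin al * (kap ph - waist al)).
Proof.
intros Hw; unfold gap_al, gap_ph.
pose proof (sin2_cos2 al) as E; unfold Rsqr in E; rewrite <- Hw.
generalize dependent (waist al); intros b; generalize (rho ph) (kap ph); intros p k.
apply Rminus_diag_uniq.
transitivity (2 * w * b * p * (1 - (sin al * sin al + cos al * cos al))); [ring|rewrite E; ring].
Qed.

(* If the second factor of [gap_al_ph] vanishes, the radii of the cylinder ending at the two
   contact points are parallel, so their projected distance is [0] or [2 r]. *)
Lemma parallel_radii (al ph w : R) : w * w = m * m -> 0 <= room al -> gap al ph = 0 ->
  - waist al * (cos al * rho ph - sin al * z) - w * sin al * (kap ph - waist al) = 0 ->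
  pair_len (- w) al ph * (4 * r * r - pair_len (- w) al ph) = 0.
Proof.
intros Hw Hroom Hg Hx.
pose proof (waist_sqr al Hroom) as Hb; unfold room in Hb.
pose proof (sin2_cos2 al) as E; unfold Rsqr in E.
pose proof (sin2_cos2 ph) as E'; unfold Rsqr in E'.
assert (Hrk : x * x + y * y = rho ph * rho ph + kap ph * kap ph).
{ unfold rho, kap; transitivity ((x * x + y * y) * (sin ph * sin ph + cos ph * cos ph)); [rewrite E'; ring|ring]. }
unfold gap in Hg; rewrite Hrk in Hg; unfold pair_len.
revert Hb Hg Hx; generalize (waist al) (rho ph) (kap ph); intros b p k Hb Hg Hx.
(* In an orthonormal basis of the plane orthogonal to the axis, [(u, v)] is the radius ending at
   [(x, y, z)] and [(u', v')] the one ending at [(0, 0, - w)]; [X] is their determinant. *)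
set (u := cos al * p - sin al * z) in *; set (v := k - b) in *.
set (u' := w * sin al); set (v' := - b).
assert (N : u * u + v * v = r * r).
{ unfold u, v; assert (Z : (sin al * sin al + cos al * cos al) * (p * p + z * z) = p * p + z * z)
  by (rewrite E; ring); nra. }
assert (N' : u' * u' + v' * v' = r * r).
{ unfold u', v'; rewrite <- Hw in Hb; lra. }
assert (X : u * v' - u' * v = 0) by (unfold u', v'; lra).
(* Lagrange's identity with zero determinant: the scalar product of the radii is [r^2] or
   [- r^2]. *)
assert (Hdot : (u * u' + v * v') * (u * u' + v * v') = r * r * (r * r)).
{ rewrite <- N at 1; rewrite <- N'.
  transitivity ((u * u + v * v) * (u' * u' + v' * v') - (u * v' - u' * v) * (u * v' - u' * v)); [ring|rewrite X; ring]. }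
replace (cos al * p - sin al * (z - - w)) with (u - u') by (unfold u, u'; ring).
replace k with (v - v') by (unfold v, v'; ring).
replace ((u - u') * (u - u') + (v - v') * (v - v')) with (2 * (r * r) - 2 * (u * u' + v * v')).
- transitivity (4 * (r * r * (r * r) - (u * u' + v * v') * (u * u' + v * v'))); [ring|rewrite Hdot; ring].
- transitivity ((u * u + v * v) + (u' * u' + v' * v') - 2 * (u * u' + v * v')); [rewrite N, N'; ring|ring].
Qed.

(** The slope of the curve is [- gap_al / (waist * gap_ph)], so its absolute value never equals
    [m / waist] away from special positions. Equality would annihilate [gap_al + w * gap_ph] for
    [w = m] or [w = - m], and each factor in [gap_al_ph] then yields a special pair. *)
Lemma gap_slopes (al ph : R) : 0 <= room al -> gap al ph = 0 -> special al ph <> 0 ->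
  Rabs (gap_al al ph) <> m * Rabs (gap_ph al ph).
Proof.
intros Hroom Hg Hs E.
assert (Z : (gap_al al ph + m * gap_ph al ph) * (gap_al al ph + (- m) * gap_ph al ph) = 0).
{ transitivity (Rabs (gap_al al ph) * Rabs (gap_al al ph) -
    m * m * (Rabs (gap_ph al ph) * Rabs (gap_ph al ph))).
  - rewrite <- !Rabs_mult, !Rabs_right by apply Rle_ge, Rle_0_sqr; ring.
  - rewrite E; ring. }
assert (fac : forall w, w * w = m * m -> gap_al al ph + w * gap_ph al ph = 0 ->
  pair_special w al ph * pair_special (- w) al ph = 0).
{ intros w Hw H; rewrite gap_al_ph in H by auto.
  apply Rmult_integral in H; destruct H as [H|H]; unfold pair_special.
  - replace (sin al * rho ph + cos al * (z - w)) with 0 by lra; ring.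
  - rewrite (parallel_radii al ph w) by auto; ring. }
apply Hs; unfold special; rewrite Rmult_assoc.
apply Rmult_integral in Z; destruct Z as [Z|Z]; apply fac in Z; try ring.
- rewrite Z; ring.
- rewrite Ropp_involutive in Z; rewrite (Rmult_comm (pair_special m al ph)), Z; ring.
Qed.

(** [kap ph = 0] means that the direction is parallel to the plane of the three contacts. They then
    project to collinear points of a circle, and the third projection coincides with one of the
    other two. *)
Lemma special_coplanar (al ph : R) : 0 <= room al -> gap al ph = 0 -> kap ph = 0 -> special al ph = 0.
Proof.
intros Hroom Hg Hk.
pose proof (sin2_cos2 al) as E; unfold Rsqr in E.
pose proof (sin2_cos2 ph) as E'; unfold Rsqr in E'.
assert (Hrk : x * x + y * y = rho ph * rho ph).
{ transitivity (rho ph * rho ph + kap ph * kap ph); [|rewrite Hk; ring].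
  unfold rho, kap; transitivity ((x * x + y * y) * (sin ph * sin ph + cos ph * cos ph)); [rewrite E'; ring|ring]. }
unfold gap in Hg; rewrite Hk, Hrk in Hg.
assert (Z : (cos al * rho ph - sin al * (z - m)) * (cos al * rho ph - sin al * (z - - m)) = 0).
{ assert (Z : (sin al * sin al + cos al * cos al) * (rho ph * rho ph + z * z) = rho ph * rho ph + z * z)
  by (rewrite E; ring); nra. }
unfold special, pair_special, pair_len; rewrite Hk.
apply Rmult_integral in Z; destruct Z as [-> | ->]; ring.
Qed.

Lemma room_cont al ph : continuity_2d_pt (fun al _ => room al) al ph.
Proof. gunfold; cont2d. Qed.
Lemma gap_cont al ph : continuity_2d_pt gap al ph.
Proof. gunfold; cont2d. Qed.
Lemma gap_al_cont al ph : continuity_2d_pt gap_al al ph.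
Proof. gunfold; cont2d. Qed.
Lemma gap_ph_cont al ph : continuity_2d_pt gap_ph al ph.
Proof. gunfold; cont2d. Qed.
Lemma waist_cont al ph : continuity_2d_pt (fun al _ => waist al) al ph.
Proof. gunfold; cont2d. Qed.
Lemma special_cont al ph : continuity_2d_pt special al ph.
Proof. gunfold; cont2d. Qed.

Lemma common_box (f1 f2 : R -> R -> R) (al ph : R) :
  continuity_2d_pt f1 al ph -> continuity_2d_pt f2 al ph ->
  0 < room al -> special al ph <> 0 -> 0 < f1 al ph -> 0 < f2 al ph ->
  exists d, 0 < d /\ forall u v, Rabs (u - al) < d -> Rabs (v - ph) < d ->
    0 < room u /\ special u v <> 0 /\ 0 < f1 u v /\ 0 < f2 u v.
Proof.
intros C1 C2 H0 Hs H1 H2.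
destruct (continuity_2d_pos (fun u _ => room u) al ph) as (d0 & D0 & P0); auto using room_cont.
destruct (continuity_2d_pos (fun u v => Rabs (special u v)) al ph) as (d3 & D3 & P3).
{ apply continuity_1d_2d_pt_comp; [apply Rcontinuity_abs|apply special_cont]. }
{ apply Rabs_pos_lt; auto. }
destruct (continuity_2d_pos f1 al ph) as (d1 & D1 & P1); auto.
destruct (continuity_2d_pos f2 al ph) as (d2 & D2 & P2); auto.
exists (Rmin (Rmin d0 d3) (Rmin d1 d2)); split; [repeat apply Rmin_glb_lt; auto|].
intros u v Hu Hv.
pose proof (Rmin_l (Rmin d0 d3) (Rmin d1 d2)); pose proof (Rmin_r (Rmin d0 d3) (Rmin d1 d2)).
pose proof (Rmin_l d0 d3); pose proof (Rmin_r d0 d3).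
pose proof (Rmin_l d1 d2); pose proof (Rmin_r d1 d2).
split; [apply (P0 u v); lra|split; [|split; [apply P1; lra|apply P2; lra]]].
intros E; assert (Q : 0 < Rabs (special u v)) by (apply P3; lra).
rewrite E, Rabs_R0 in Q; lra.
Qed.

(** The common tangents, restricted by a non-strict sign condition [f] on the slope, so that the set
    is closed; [room] is required because [sqrt] is [0] on negative numbers. *)
Definition on_curve (f : R -> R -> R) (al ph : R) : Prop :=
  0 <= room al /\ gap al ph = 0 /\ f al ph <= 0.

Lemma on_curve_closed (f : R -> R -> R) (al ph : R) : continuity_2d_pt f al ph ->
  (forall e, 0 < e -> exists u v, Rabs (u - al) < e /\ Rabs (v - ph) < e /\ on_curve f u v) ->
  on_curve f al ph.
Proof.
intros Cf H; split; [|split].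
- assert (- room al <= 0); [|lra].
  apply (continuity_2d_limit_le (fun u _ => - room u) (on_curve f) al ph); auto.
  + apply continuity_2d_pt_opp, room_cont.
  + intros u v [Hu _]; lra.
- apply Rle_antisym.
  + apply (continuity_2d_limit_le gap (on_curve f) al ph); auto using gap_cont.
    intros u v (_ & Hu & _); lra.
  + assert (- gap al ph <= 0); [|lra].
    apply (continuity_2d_limit_le (fun u v => - gap u v) (on_curve f) al ph); auto.
    * apply continuity_2d_pt_opp, gap_cont.
    * intros u v (_ & Hu & _); lra.
- apply (continuity_2d_limit_le f (on_curve f) al ph); auto.
  intros u v (_ & _ & Hu); auto.
Qed.

Lemma room_pos_of_special (al ph : R) : 0 <= room al -> special al ph <> 0 -> 0 < room al.
Proof.
intros H Hs; destruct (Req_dec (room al) 0) as [E|]; [|lra].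
elim Hs; unfold special, waist; rewrite E, sqrt_0; ring.
Qed.

Lemma sign_choice (u : R) : exists sg, sg * sg = 1 /\ Rabs u = sg * u.
Proof.
destruct (Rcase_abs u); [exists (-1); rewrite Rabs_left by lra|exists 1; rewrite Rabs_right by lra]; lra.
Qed.

Lemma sign_inj (sg u : R) : sg * sg = 1 -> sg * u = 0 -> u = 0.
Proof. intros H E; replace u with (sg * (sg * u)) by (rewrite <- Rmult_assoc, H; ring); rewrite E; ring. Qed.

Lemma sign_abs (sg u : R) : sg * sg = 1 -> Rabs (sg * u) = Rabs u.
Proof.
intros H; rewrite Rabs_mult.
assert (E : (Rabs sg - 1) * (Rabs sg + 1) = 0).
{ transitivity (Rabs sg * Rabs sg - 1); [ring|].
  rewrite <- Rabs_mult, H, Rabs_R1; ring. }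
pose proof (Rabs_pos sg); apply Rmult_integral in E; destruct E; [|lra].
replace (Rabs sg) with 1 by lra; ring.
Qed.

(** [flat <= 0] says [|d ph / d al| <= m / waist], and [steep <= 0] says
    [|d al / d ph| <= waist / m]: the curve is a graph over [al], respectively over [ph]. *)
Let flat (al ph : R) : R := Rabs (gap_al al ph) - m * Rabs (gap_ph al ph).
Let steep (al ph : R) : R := m * Rabs (gap_ph al ph) - Rabs (gap_al al ph).

Lemma flat_cont al ph : continuity_2d_pt flat al ph.
Proof. unfold flat; pose proof (gap_al_cont al ph); pose proof (gap_ph_cont al ph); cont2d. Qed.
Lemma steep_cont al ph : continuity_2d_pt steep al ph.
Proof. unfold steep; pose proof (gap_al_cont al ph); pose proof (gap_ph_cont al ph); cont2d. Qed.

(** By [gap_slopes] the inequality [flat <= 0] is strict here, hence persists in a box, where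
    [box_graph] applies with [al] as abscissa. Points of the local curve thus satisfy [flat <= 0]
    again: the curve cannot change regime. *)
Lemma flat_local (K al ph : R) : 0 < K -> m <= K * waist al ->
  on_curve flat al ph -> special al ph <> 0 ->
  exists d e, 0 < d /\ 0 < e /\
    (forall u, Rabs (u - al) < d -> exists v, Rabs (v - ph) < e /\ on_curve flat u v /\ special u v <> 0) /\
    (forall u1 v1 u2 v2, Rabs (u1 - al) < d -> Rabs (v1 - ph) < e -> Rabs (u2 - al) < d ->
       Rabs (v2 - ph) < e -> on_curve flat u1 v1 -> on_curve flat u2 v2 ->
       Rabs (v1 - v2) <= K * Rabs (u1 - u2)).
Proof.
intros HK HKw (Hroom & Hg & Hf) Hs.
assert (Hroom' := room_pos_of_special al ph Hroom Hs).
pose proof (gap_slopes al ph Hroom Hg Hs) as Hne; unfold flat in Hf.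
(* [box_graph] needs a positive derivative in the ordinate; multiplying [gap] by the sign of
   [gap_ph] provides it. *)
destruct (sign_choice (gap_ph al ph)) as (sg & Hsg & Habs).
destruct (common_box steep (fun u v => K * (waist u * (sg * gap_ph u v)) - Rabs (gap_al u v)) al ph)
  as (e & He & Hbox); auto.
- apply steep_cont.
- pose proof (gap_al_cont al ph); pose proof (gap_ph_cont al ph); pose proof (waist_cont al ph); cont2d.
- unfold steep; lra.
- rewrite <- Habs.
  assert (m * Rabs (gap_ph al ph) <= K * (waist al * Rabs (gap_ph al ph))); [|lra].
  rewrite <- Rmult_assoc; apply Rmult_le_compat_r; [apply Rabs_pos|auto].
- destruct (box_graph (fun u v => sg * gap u v) (fun u v => sg * (gap_al u v / waist u))
    (fun u v => sg * gap_ph u v) K al ph e) as (d & Hd & Hde & Hex & Hlip); auto.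
  + intros u v Hu Hv i j; destruct (Hbox u v Hu Hv) as (R & _).
    replace (i * (sg * (gap_al u v / waist u)) + j * (sg * gap_ph u v))
      with (sg * (i * (gap_al u v / waist u) + j * gap_ph u v)) by ring.
    apply is_derive_scal, gap_derive; auto.
  + intros u v Hu Hv; destruct (Hbox u v Hu Hv) as (R & _ & _ & S).
    assert (W := waist_pos u R).
    rewrite sign_abs by auto; unfold Rdiv; rewrite Rabs_mult, Rabs_inv, (Rabs_right (waist u)) by lra.
    apply Rmult_lt_reg_r with (waist u); auto.
    rewrite Rmult_assoc, Rinv_l by lra; lra.
  + rewrite Hg; ring.
  + exists d, e; split; [auto|split; [auto|split]].
    * intros u Hu; destruct (Hex u Hu) as (v & Hv & E).
      destruct (Hbox u v) as (R & S & T & _); auto; [lra|].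
      exists v; split; auto; split; auto; split; [lra|split].
      -- apply (sign_inj sg); auto.
      -- unfold flat, steep in *; lra.
    * intros u1 v1 u2 v2 A1 A2 A3 A4 (_ & E1 & _) (_ & E2 & _); apply Hlip; auto.
      -- rewrite E1; ring.
      -- rewrite E2; ring.
Qed.

(** The counterpart of [flat_local] with [ph] as abscissa and [al] as ordinate. *)
Lemma steep_local (K al ph : R) : 0 < K -> waist al <= K * m ->
  on_curve steep al ph -> special al ph <> 0 ->
  exists d e, 0 < d /\ 0 < e /\
    (forall v, Rabs (v - ph) < d -> exists u, Rabs (u - al) < e /\ on_curve steep u v /\ special u v <> 0) /\
    (forall v1 u1 v2 u2, Rabs (v1 - ph) < d -> Rabs (u1 - al) < e -> Rabs (v2 - ph) < d ->
       Rabs (u2 - al) < e -> on_curve steep u1 v1 -> on_curve steep u2 v2 ->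
       Rabs (u1 - u2) <= K * Rabs (v1 - v2)).
Proof.
intros HK HKw (Hroom & Hg & Hf) Hs.
assert (Hroom' := room_pos_of_special al ph Hroom Hs).
pose proof (gap_slopes al ph Hroom Hg Hs) as Hne; unfold steep in Hf.
destruct (sign_choice (gap_al al ph)) as (sg & Hsg & Habs).
destruct (common_box flat (fun u v => K * (sg * gap_al u v) - waist u * Rabs (gap_ph u v)) al ph)
  as (e & He & Hbox); auto.
- apply flat_cont.
- pose proof (gap_al_cont al ph); pose proof (gap_ph_cont al ph); pose proof (waist_cont al ph); cont2d.
- unfold flat; lra.
- rewrite <- Habs.
  assert (waist al * Rabs (gap_ph al ph) <= K * (m * Rabs (gap_ph al ph))).
  { rewrite <- Rmult_assoc; apply Rmult_le_compat_r; [apply Rabs_pos|auto]. }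
  assert (K * (m * Rabs (gap_ph al ph)) < K * Rabs (gap_al al ph)) by (apply Rmult_lt_compat_l; lra).
  lra.
- destruct (box_graph (fun v u => sg * gap u v) (fun v u => sg * gap_ph u v)
    (fun v u => sg * (gap_al u v / waist u)) K ph al e) as (d & Hd & Hde & Hex & Hlip); auto.
  + intros v u Hv Hu i j; destruct (Hbox u v Hu Hv) as (R & _).
    replace (i * (sg * gap_ph u v) + j * (sg * (gap_al u v / waist u)))
      with (sg * (j * (gap_al u v / waist u) + i * gap_ph u v)) by ring.
    apply (is_derive_scal (fun t => gap (u + j * t) (v + i * t))), gap_derive; auto.
  + intros v u Hv Hu; destruct (Hbox u v Hu Hv) as (R & _ & _ & S).
    assert (W := waist_pos u R).
    rewrite sign_abs by auto.
    apply Rmult_lt_reg_l with (waist u); auto.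
    replace (waist u * (K * (sg * (gap_al u v / waist u)))) with (K * (sg * gap_al u v)) by (field; lra).
    lra.
  + rewrite Hg; ring.
  + exists d, e; split; [auto|split; [auto|split]].
    * intros v Hv; destruct (Hex v Hv) as (u & Hu & E).
      destruct (Hbox u v) as (R & S & T & _); auto; [lra|].
      exists u; split; auto; split; auto; split; [lra|split].
      -- apply (sign_inj sg); auto.
      -- unfold flat, steep in *; lra.
    * intros v1 u1 v2 u2 A1 A2 A3 A4 (_ & E1 & _) (_ & E2 & _); apply Hlip; auto.
      -- rewrite E1; ring.
      -- rewrite E2; ring.
Qed.

Lemma room_antitone (al al' : R) : 0 <= al <= al' -> al' <= PI / 2 -> room al' <= room al.
Proof.
intros H H'; unfold room.
assert (0 <= sin al) by (apply sin_ge_0; lra).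
assert (sin al <= sin al') by (apply sin_incr_1; lra).
assert (sin al * sin al <= sin al' * sin al') by (apply Rmult_le_compat; auto).
assert (0 < m * m) by (apply Rmult_lt_0_compat; auto).
assert (m * m * (sin al * sin al) <= m * m * (sin al' * sin al')) by (apply Rmult_le_compat_l; lra).
lra.
Qed.

Lemma waist_antitone (al al' : R) : 0 <= al <= al' -> al' <= PI / 2 -> waist al' <= waist al.
Proof. intros; apply sqrt_le_1_alt, room_antitone; auto. Qed.

Lemma waist_le (al : R) : waist al <= r.
Proof.
rewrite <- (sqrt_square r) by lra; apply sqrt_le_1_alt; unfold room.
pose proof (Rle_0_sqr (m * sin al)) as H; unfold Rsqr in H; lra.
Qed.

(** The regime at the start decides the parameter. A flat curve is followed down to [al = 0], a
    steep one over [ph] from [0] to [PI], unless a special position comes first. *)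
Lemma tangent_curve (al0 : R) : 0 <= al0 <= PI / 2 -> 0 <= room al0 -> gap al0 0 = 0 ->
  exists f g : R -> R, (forall t, continuity_pt f t) /\ (forall t, continuity_pt g t) /\
    f 0 = al0 /\ g 0 = 0 /\
    (forall t, 0 <= t <= 1 -> 0 <= room (f t) /\ gap (f t) (g t) = 0) /\
    special (f 1) (g 1) = 0.
Proof.
intros Hal Hroom Hg.
destruct (Req_dec (special al0 0) 0) as [E|Hs].
{ exists (fun _ => al0), (fun _ => 0); repeat split; auto; intros; apply cp_const. }
assert (Hal0 : al0 <> 0).
{ intros ->; apply Hs; unfold special; rewrite sin_0; ring. }
assert (Hw := waist_pos al0 (room_pos_of_special al0 0 Hroom Hs)).
destruct (Rle_or_lt (flat al0 0) 0) as [Hf|Hf].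
(* The abscissa is [- al], since [follow_branch] moves to the right. As [al] decreases [waist]
   grows, so the slope bound at [al0] serves throughout. *)
- assert (HK : 0 < m / waist al0) by (apply Rdiv_lt_0_compat; auto).
  destruct (follow_branch (fun x y => on_curve flat (- x) y) (fun x y => special (- x) y = 0)
     (m / waist al0) (- al0) 0 0) as (x1 & Y & Hx1 & HL & HY0 & HA & HB); auto; try lra.
  + rewrite Ropp_involutive; repeat split; auto.
  + intros u v H; apply on_curve_closed; [apply flat_cont|].
    intros e He; destruct (H e He) as (u' & v' & A1 & A2 & A3).
    exists (- u'), v'; split; [rewrite <- Rabs_Ropp; replace (- (- u' - - u)) with (u' - u) by ring; auto|auto].
  + intros u v Hu HA HB.
    destruct (flat_local (m / waist al0) (- u) v) as (d & e & Hd & He & Hex & Hlip); auto.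
    { apply Rle_trans with (m / waist al0 * waist al0); [right; field; lra|].
      apply Rmult_le_compat_l; [lra|apply waist_antitone; lra]. }
    assert (neg : forall u', Rabs (- u' - - u) = Rabs (u' - u)).
    { intros u'; rewrite <- Rabs_Ropp; f_equal; ring. }
    exists d, e; split; [auto|split; [auto|split]].
    * intros u' Hu'; apply Hex; rewrite neg; auto.
    * intros u1 v1 u2 v2 A1 A2 A3 A4 A5 A6.
      replace (u1 - u2) with (- u2 - - u1) by ring; rewrite (Rabs_minus_sym (- u2)).
      apply Hlip; rewrite ?neg; auto.
  + exists (fun t => - (- al0 + t * (x1 - - al0))), (fun t => Y (- al0 + t * (x1 - - al0))).
    assert (HcY := lipschitz_cont _ _ HK HL).
    split; [intros t; cont|split; [intros t; apply (cp_comp (fun t => - al0 + t * (x1 - - al0)) Y); cont|]].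
    split; [ring|split; [rewrite Rmult_0_l, Rplus_0_r; auto|split]].
    * intros t Ht; destruct (HA (- al0 + t * (x1 - - al0))) as (?&?&_); [split; nra|auto].
    * replace (- al0 + 1 * (x1 - - al0)) with x1 by ring.
      destruct HB as [-> |]; auto.
      unfold special; rewrite Ropp_0, sin_0; ring.
(* Here [waist / m <= r / m] bounds the slope everywhere. *)
- assert (HK : 0 < r / m) by (apply Rdiv_lt_0_compat; auto).
  pose proof PI_RGT_0.
  destruct (follow_branch (fun v u => on_curve steep u v) (fun v u => special u v = 0)
     (r / m) 0 PI al0) as (x1 & Y & Hx1 & HL & HY0 & HA & HB); auto; try lra.
  + repeat split; auto; unfold flat, steep in *; lra.
  + intros v u H'; apply on_curve_closed; [apply steep_cont|].
    intros e He; destruct (H' e He) as (v' & u' & A1 & A2 & A3); exists u', v'; auto.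
  + intros v u Hv HA HB; apply steep_local; auto.
    replace (r / m * m) with r by (field; lra); apply waist_le.
  + assert (HcY := lipschitz_cont _ _ HK HL).
    assert (Hend : exists x2, 0 <= x2 <= x1 /\ special (Y x2) x2 = 0).
    { destruct HB as [-> |]; [|exists x1; split; auto; lra].
      (* [kap PI = - kap 0], so [kap] has a zero on the way, which is special by
         [special_coplanar]. *)
      destruct (IVT_cor kap 0 PI) as (x2 & Hx2 & E).
      - intros t; unfold kap; cont.
      - lra.
      - unfold kap; rewrite cos_0, sin_0, cos_PI, sin_PI; nra.
      - exists x2; split; auto; destruct (HA x2 Hx2) as (?&?&_); apply special_coplanar; auto. }
    destruct Hend as (x2 & Hx2 & Hsp).
    exists (fun t => Y (t * x2)), (fun t => t * x2).
    split; [intros t; apply (cp_comp (fun t => t * x2) Y); cont|split; [intros t; cont|]].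
    split; [rewrite Rmult_0_l; auto|split; [ring|split]].
    * intros t Ht; destruct (HA (t * x2)) as (?&?&_); [split; nra|auto].
    * rewrite Rmult_1_l; auto.
Qed.

End Tangents.

(** * The chart of common tangents to two spheres *)

Definition cross (u v : pt) : pt :=
  mkpt (py u * pz v - pz u * py v) (pz u * px v - px u * pz v) (px u * py v - py u * px v).

Lemma cross_dot_l u v : dot (cross u v) u = 0.
Proof. unfold cross; vring. Qed.
Lemma cross_dot_r u v : dot (cross u v) v = 0.
Proof. unfold cross; vring. Qed.
Lemma cross_norm u v : dot (cross u v) (cross u v) = dot u u * dot v v - dot u v * dot u v.
Proof. unfold cross; vring. Qed.

Lemma perp_unit (d : pt) : d <> zero -> exists e, dot e e = 1 /\ dot e d = 0.
Proof.
intros Hd; apply dot_self_pos in Hd.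
assert (H : exists e, 0 < dot e e /\ dot e d = 0).
{ destruct (Req_dec (px d) 0) as [E|E].
  - exists (mkpt 1 0 0); revert E; vring; intros; lra.
  - exists (mkpt (- py d) (px d) 0); revert E; vring; intros; split; [nra|ring]. }
destruct H as (e & He & Hed).
assert (Hs : 0 < sqrt (dot e e)) by (apply sqrt_lt_R0; auto).
exists (vscale (/ sqrt (dot e e)) e); dexp; rewrite Hed; split; [|ring].
rewrite <- (sqrt_sqrt (dot e e)) at 3 by lra; field; lra.
Qed.

Section Frame.
Variables (o f1 f2 f3 : pt).

Definition orthonormal : Prop :=
  dot f1 f1 = 1 /\ dot f2 f2 = 1 /\ dot f3 f3 = 1 /\ dot f1 f2 = 0 /\ dot f1 f3 = 0 /\ dot f2 f3 = 0.
Definition lin (X : pt) : pt := vadd (vadd (vscale (px X) f1) (vscale (py X) f2)) (vscale (pz X) f3).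
Definition fr (X : pt) : pt := vadd o (lin X).

Lemma lin_sub X Y : lin (vsub X Y) = vsub (lin X) (lin Y).
Proof. unfold lin; apply pt_ext; vring. Qed.

Lemma fr_sub X Y : vsub (fr X) (fr Y) = lin (vsub X Y).
Proof. rewrite lin_sub; unfold fr; apply pt_ext; vring. Qed.

Lemma cont_lin (A : R -> pt) : cont_pt A -> cont_pt (fun t => lin (A t)).
Proof.
intros H t; destruct (H t) as (?&?&?); unfold lin, vadd, vscale, mkpt, px, py, pz in *; simpl.
repeat split; cont.
Qed.

Lemma cont_fr (A : R -> pt) : cont_pt A -> cont_pt (fun t => fr (A t)).
Proof.
intros H t; destruct (cont_lin A H t) as (?&?&?); unfold fr; repeat split; unfold vadd, mkpt, px, py, pz in *; simpl;
  cont.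
Qed.

Hypothesis H : orthonormal.

Lemma lin_dot X Y : dot (lin X) (lin Y) = dot X Y.
Proof.
destruct H as (H11&H22&H33&H12&H13&H23); unfold lin; dexp.
rewrite (dot_sym f2 f1), (dot_sym f3 f1), (dot_sym f3 f2), H11, H22, H33, H12, H13, H23.
unfold dot; ring.
Qed.

Lemma excess_fr A D r X : excess (fr A) (lin D) r (fr X) = excess A D r X.
Proof. unfold excess; rewrite fr_sub, !lin_dot; auto. Qed.

(* A vector orthogonal to the frame is killed by the determinant of the frame (Cramer), whose square
   is the Gram determinant 1. *)
Lemma lin_coords v : v = lin (mkpt (dot v f1) (dot v f2) (dot v f3)).
Proof.
destruct H as (H11&H22&H33&H12&H13&H23).
set (c := mkpt (dot v f1) (dot v f2) (dot v f3)); set (w := vsub v (lin c)).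
assert (W : dot w f1 = 0 /\ dot w f2 = 0 /\ dot w f3 = 0).
{ unfold w, lin, c; cbn [px py pz mkpt fst snd]; unfold px, py, pz, mkpt; simpl fst; simpl snd.
  dexp; rewrite (dot_sym f2 f1), (dot_sym f3 f1), (dot_sym f3 f2), H11, H22, H33, H12, H13, H23; lra. }
destruct W as (W1&W2&W3).
assert (G : dot f1 (cross f2 f3) * dot f1 (cross f2 f3) = 1).
{ transitivity (dot f1 f1 * (dot f2 f2 * dot f3 f3 - dot f2 f3 * dot f2 f3)
    - dot f1 f2 * (dot f1 f2 * dot f3 f3 - dot f2 f3 * dot f1 f3)
    + dot f1 f3 * (dot f1 f2 * dot f2 f3 - dot f2 f2 * dot f1 f3)).
  - unfold cross; clear; vring.
  - rewrite H11, H22, H33, H12, H13, H23; ring. }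
assert (Z : vscale (dot f1 (cross f2 f3)) w = zero).
{ transitivity (vadd (vadd (vscale (dot w f1) (cross f2 f3)) (vscale (dot w f2) (cross f3 f1)))
    (vscale (dot w f3) (cross f1 f2))).
  - clear; generalize w; unfold cross; clear; intros; apply pt_ext; vring.
  - rewrite W1, W2, W3; apply pt_ext; clear; unfold cross; vring. }
assert (w0 : w = zero).
{ apply dot_self_0.
  transitivity (dot f1 (cross f2 f3) * dot f1 (cross f2 f3) * dot w w); [rewrite G; ring|].
  transitivity (dot (vscale (dot f1 (cross f2 f3)) w) (vscale (dot f1 (cross f2 f3)) w)); [dexp; ring|].
  rewrite Z; clear; vring. }
revert w0; unfold w; generalize (lin c); clear; intros u E; apply pt_ext;
  [apply (f_equal px) in E|apply (f_equal py) in E|apply (f_equal pz) in E]; revert E; vring; lra.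
Qed.

Lemma fr_surj v : exists x y z, v = fr (mkpt x y z).
Proof.
exists (dot (vsub v o) f1), (dot (vsub v o) f2), (dot (vsub v o) f3).
unfold fr; rewrite <- lin_coords; apply pt_ext; vring.
Qed.

End Frame.

Lemma collinear_incl (l l' : list pt) : incl l l' -> collinear l' -> collinear l.
Proof. intros Hi (a & d & Hd & H); exists a, d; split; auto. Qed.

Lemma not_collinear_triple (p q s : pt) :
  let e := vsub q p in let f := vsub s p in
  dot e e * dot f f - dot e f * dot e f <> 0 -> ~ collinear (p :: q :: s :: nil).
Proof.
intros e f N (a & d & _ & H).
destruct (H p) as (t1 & E1); [simpl; auto|].
destruct (H q) as (t2 & E2); [simpl; auto|].
destruct (H s) as (t3 & E3); [simpl; auto|].
apply N; unfold e, f; rewrite E1, E2, E3; clear; vring.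
Qed.

(** The conclusion of the theorem as a property of the starting line, so that motions can be
    prepended one at a time. *)
Definition reaches (P : list pt) (r : R) (a d : pt) : Prop :=
  exists a' d' : pt,
    d' <> zero /\ enclosed P a' d' r /\ motion P r a d a' d' /\
    ((exists p1 p2 p3 p4,
        In p1 P /\ In p2 P /\ In p3 P /\ In p4 P /\
        NoDup (p1 :: p2 :: p3 :: p4 :: nil) /\
        ~ collinear (p1 :: p2 :: p3 :: p4 :: nil) /\
        on_cylinder a' d' r p1 /\ on_cylinder a' d' r p2 /\
        on_cylinder a' d' r p3 /\ on_cylinder a' d' r p4)
     \/
     (exists p q s,
        In p P /\ In q P /\ In s P /\
        ~ collinear (p :: q :: s :: nil) /\
        on_cylinder a' d' r p /\ on_cylinder a' d' r q /\ on_cylinder a' d' r s /\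
        (cond_a p q a' d' r \/ cond_b p q a' d' r \/ cond_c p q a' d' r))).

Lemma reaches_motion (P : list pt) (r : R) (a d a1 d1 : pt) :
  motion P r a d a1 d1 -> reaches P r a1 d1 -> reaches P r a d.
Proof.
intros M (a' & d' & H0 & H1 & M' & H2); exists a', d'; repeat split; auto.
apply motion_trans with (1 := M); auto.
Qed.

Lemma reaches_special (P : list pt) (r : R) (a d p q s : pt) : 0 < r -> dot d d = 1 ->
  enclosed P a d r -> In p P -> In q P -> In s P -> ~ collinear (p :: q :: s :: nil) -> p <> q ->
  excess a d r p = 0 -> excess a d r q = 0 -> excess a d r s = 0 ->
  (let e := vsub q p in let L := dot e e - dot e d * dot e d in
   L * (4 * r * r - L) * dot e d = 0) ->
  reaches P r a d.
Proof.
intros Hr Hd He Pp Pq Ps Hc Hpq Ep Eq Es H.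
assert (Hd0 := dot_self_1 _ Hd).
exists a, d; split; [auto|split; [auto|split]].
- apply (motion_intro P r (fun _ => a) (fun _ => d)); auto; intros t; repeat split; cont.
- right; exists p, q, s; repeat split; auto; try (apply dist_line_eq_iff; auto).
  apply special_pair; auto.
Qed.

Section Chart.
Variables (P : list pt) (r m : R) (o f1 f2 f3 : pt).
Hypothesis Hr : 0 < r.
Hypothesis Hm : 0 < m.
Hypothesis Hf : orthonormal f1 f2 f3.
Notation FR := (fr o f1 f2 f3).
Notation LIN := (lin f1 f2 f3).
Hypothesis Hp : In (FR (mkpt 0 0 (- m))) P.
Hypothesis Hq : In (FR (mkpt 0 0 m)) P.

Definition axis_pt (al ph : R) : pt := mkpt (- waist m r al * sin ph) (waist m r al * cos ph) 0.
Definition axis_dir (al ph : R) : pt := mkpt (sin al * cos ph) (sin al * sin ph) (cos al).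

Lemma axis_dir_unit (al ph : R) : dot (axis_dir al ph) (axis_dir al ph) = 1.
Proof.
unfold axis_dir; vunfold.
pose proof (sin2_cos2 al) as E; pose proof (sin2_cos2 ph) as E'; unfold Rsqr in E, E'.
transitivity (sin al * sin al * (sin ph * sin ph + cos ph * cos ph) + cos al * cos al); [ring|].
rewrite E'; lra.
Qed.

Lemma excess_chart (al ph x y z : R) : 0 <= room m r al ->
  excess (FR (axis_pt al ph)) (LIN (axis_dir al ph)) r (FR (mkpt x y z)) = gap m r x y z al ph.
Proof.
intros Hroom; rewrite excess_fr by auto; unfold excess; rewrite axis_dir_unit.
pose proof (waist_sqr m r al Hroom) as Hb; unfold room in Hb.
pose proof (sin2_cos2 ph) as E'; unfold Rsqr in E'.
unfold axis_pt, axis_dir, gap, rho, kap; vunfold; revert Hb; generalize (waist m r al); intros b Hb.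
apply Rminus_diag_uniq.
match goal with |- ?u = 0 => replace u with
  (b * b * (sin ph * sin ph + cos ph * cos ph) - (r * r - m * m * (sin al * sin al))) by ring end.
rewrite E', Hb; ring.
Qed.

(** At [z = m] and [z = - m] this is zero, so both contacts persist throughout the chart. A point
    between them is never outside the cylinder, so it cannot trigger a stop. *)
Lemma gap_on_axis (z al ph : R) : gap m r 0 0 z al ph = sin al * sin al * (z * z - m * m).
Proof.
unfold gap, rho, kap; pose proof (sin2_cos2 al) as E; unfold Rsqr in E.
transitivity (z * z * (1 - cos al * cos al) - m * m * (sin al * sin al)); [ring|].
replace (1 - cos al * cos al) with (sin al * sin al) by lra; ring.
Qed.

(** Identifies [pair_len] with the quantity [L] of [special_pair]. *)
Lemma pair_len_eq (x y z w al ph : R) :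
  let e := mkpt x y (z - w) in
  dot e e - dot e (axis_dir al ph) * dot e (axis_dir al ph) = pair_len x y z w al ph.
Proof.
unfold axis_dir, pair_len, rho, kap; vunfold.
pose proof (sin2_cos2 al) as E; pose proof (sin2_cos2 ph) as E'; unfold Rsqr in E, E'.
apply Rminus_diag_uniq.
set (p := x * cos ph + y * sin ph); set (k := y * cos ph - x * sin ph).
assert (F : x * x + y * y = p * p + k * k).
{ unfold p, k; transitivity ((x * x + y * y) * (sin ph * sin ph + cos ph * cos ph)); [rewrite E'; ring|ring]. }
replace (x * (sin al * cos ph) + y * (sin al * sin ph)) with (sin al * p) by (unfold p; ring).
rewrite F.
transitivity ((p * p + (z - w) * (z - w)) * (1 - (sin al * sin al + cos al * cos al))); [ring|rewrite E; ring].
Qed.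

Lemma axis_cont (f g : R -> R) : (forall t, continuity_pt f t) -> (forall t, continuity_pt g t) ->
  cont_pt (fun t => FR (axis_pt (f t) (g t))) /\ cont_pt (fun t => LIN (axis_dir (f t) (g t))).
Proof.
intros Cf Cg; split; [apply (cont_fr _ _ _ _ (fun t => axis_pt (f t) (g t)))
  |apply (cont_lin _ _ _ (fun t => axis_dir (f t) (g t)))]; intros t; repeat split;
  unfold axis_pt, axis_dir, waist, room, mkpt, px, py, pz; simpl; cont.
Qed.

Lemma chart_dir_unit (al ph : R) : dot (LIN (axis_dir al ph)) (LIN (axis_dir al ph)) = 1.
Proof. rewrite lin_dot by auto; apply axis_dir_unit. Qed.

Lemma chart_motion_or_contact (f g : R -> R) :
  (forall t, continuity_pt f t) -> (forall t, continuity_pt g t) ->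
  (forall t, 0 <= t <= 1 -> 0 <= room m r (f t)) ->
  enclosed P (FR (axis_pt (f 0) (g 0))) (LIN (axis_dir (f 0) (g 0))) r ->
  (forall t, 0 <= t <= 1 -> motion P r (FR (axis_pt (f 0) (g 0))) (LIN (axis_dir (f 0) (g 0)))
      (FR (axis_pt (f t) (g t))) (LIN (axis_dir (f t) (g t)))) \/
  exists T, 0 <= T <= 1 /\ motion P r (FR (axis_pt (f 0) (g 0))) (LIN (axis_dir (f 0) (g 0)))
      (FR (axis_pt (f T) (g T))) (LIN (axis_dir (f T) (g T))) /\
    exists x y z, In (FR (mkpt x y z)) P /\ gap m r x y z (f T) (g T) = 0 /\
      exists t, 0 <= t <= 1 /\ 0 < gap m r x y z (f t) (g t).
Proof.
intros Cf Cg Hroom He; destruct (axis_cont f g Cf Cg) as [CA CD].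
destruct (motion_or_contact P r _ _ Hr CA CD) as [M|(T & HT & M & X & HX & E & t & Ht & N)]; auto.
- intros t Ht; apply dot_self_1, chart_dir_unit.
- right; exists T; split; [auto|split; [auto|]].
  destruct (fr_surj o f1 f2 f3 Hf X) as (x & y & z & ->); exists x, y, z.
  rewrite excess_chart in E by auto; rewrite excess_chart in N by auto; split; [auto|split; [auto|]].
  exists t; auto.
Qed.

Lemma chart_enclosed (al ph x y z : R) : 0 <= room m r al ->
  enclosed P (FR (axis_pt al ph)) (LIN (axis_dir al ph)) r -> In (FR (mkpt x y z)) P ->
  gap m r x y z al ph <= 0.
Proof.
intros Hroom H HX; specialize (H _ HX); apply dist_line_le_iff in H; auto.
- rewrite excess_chart in H; auto.
- apply dot_self_1, chart_dir_unit.
Qed.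

Section Third.
Variables (x y z : R).
Hypothesis Hxy : 0 < x * x + y * y.
Hypothesis HX : In (FR (mkpt x y z)) P.

Lemma chart_not_collinear :
  ~ collinear (FR (mkpt 0 0 (- m)) :: FR (mkpt 0 0 m) :: FR (mkpt x y z) :: nil).
Proof.
apply not_collinear_triple; simpl; rewrite !fr_sub, !lin_dot by auto; vunfold.
assert (0 < m * m * (x * x + y * y)) by (repeat apply Rmult_lt_0_compat; auto); nra.
Qed.

Lemma chart_distinct : FR (mkpt 0 0 (- m)) <> FR (mkpt 0 0 m) /\
  FR (mkpt 0 0 (- m)) <> FR (mkpt x y z) /\ FR (mkpt 0 0 m) <> FR (mkpt x y z).
Proof.
assert (ne : forall u v, 0 < dot (vsub u v) (vsub u v) -> FR v <> FR u).
{ intros u v Huv E.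
  assert (Z : dot (vsub (FR u) (FR v)) (vsub (FR u) (FR v)) = 0) by (rewrite E; clear; vring).
  rewrite fr_sub, lin_dot in Z by auto; lra. }
pose proof (Rle_0_sqr (z - m)) as Z1; pose proof (Rle_0_sqr (z - - m)) as Z2.
pose proof (Rlt_0_sqr (m - - m) ltac:(lra)) as Z3; unfold Rsqr in *.
repeat split; apply ne; vunfold; lra.
Qed.

Lemma chart_special (al ph : R) : 0 <= room m r al ->
  enclosed P (FR (axis_pt al ph)) (LIN (axis_dir al ph)) r ->
  gap m r x y z al ph = 0 -> special m r x y z al ph = 0 ->
  reaches P r (FR (axis_pt al ph)) (LIN (axis_dir al ph)).
Proof.
intros Hroom He Hg Hs.
assert (NC := chart_not_collinear).
assert (E0 : forall w, w * w = m * m ->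
  excess (FR (axis_pt al ph)) (LIN (axis_dir al ph)) r (FR (mkpt 0 0 w)) = 0).
{ intros w Hw; rewrite excess_chart, gap_on_axis by auto; rewrite Hw; ring. }
assert (Ep := E0 (- m) ltac:(ring)); assert (Eq := E0 m eq_refl).
assert (EX : excess (FR (axis_pt al ph)) (LIN (axis_dir al ph)) r (FR (mkpt x y z)) = 0).
{ rewrite excess_chart; auto. }
destruct chart_distinct as (D1 & D2 & D3).
unfold special in Hs; apply Rmult_integral in Hs; destruct Hs as [Hs|Hs];
  [apply Rmult_integral in Hs; destruct Hs as [Hs|Hs]|].
- apply (reaches_special P r _ _ (FR (mkpt 0 0 (- m))) (FR (mkpt 0 0 m)) (FR (mkpt x y z))); auto.
  + apply chart_dir_unit.
  + cbv zeta; rewrite fr_sub, !lin_dot by auto.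
    replace (vsub (mkpt 0 0 m) (mkpt 0 0 (- m))) with (mkpt 0 0 (m - - m)) by (apply pt_ext; vunfold; ring).
    rewrite pair_len_eq; unfold pair_len, rho, kap, axis_dir; vunfold.
    (* For the pair on the third axis, [L = 4 m^2 sin^2 al], [4 r^2 - L = 4 room al] and
       [<e, d> = 2 m cos al]. *)
    transitivity (32 * m * m * m * (sin al * sin al * cos al * room m r al)); [unfold room; ring|].
    rewrite <- (waist_sqr m r al) by auto.
    transitivity (32 * m * m * m * sin al * waist m r al * (sin al * waist m r al * cos al)); [ring|].
    rewrite Hs; ring.
- apply (reaches_special P r _ _ (FR (mkpt 0 0 m)) (FR (mkpt x y z)) (FR (mkpt 0 0 (- m)))); auto.
  + apply chart_dir_unit.
  + intros HC; apply NC; apply collinear_incl with (2 := HC); intros u; simpl; tauto.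
  + cbv zeta; rewrite fr_sub, !lin_dot by auto.
    replace (vsub (mkpt x y z) (mkpt 0 0 m)) with (mkpt x y (z - m)) by (apply pt_ext; vunfold; ring).
    rewrite pair_len_eq, <- Hs; unfold pair_special, rho, axis_dir; vunfold; ring.
- apply (reaches_special P r _ _ (FR (mkpt 0 0 (- m))) (FR (mkpt x y z)) (FR (mkpt 0 0 m))); auto.
  + apply chart_dir_unit.
  + intros HC; apply NC; apply collinear_incl with (2 := HC); intros u; simpl; tauto.
  + cbv zeta; rewrite fr_sub, !lin_dot by auto.
    replace (vsub (mkpt x y z) (mkpt 0 0 (- m))) with (mkpt x y (z - - m)) by (apply pt_ext; vunfold; ring).
    rewrite pair_len_eq, <- Hs; unfold pair_special, rho, axis_dir; vunfold; ring.
Qed.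

(** Along [tangent_curve] the three contacts persist, so either its special end is reached or
    another point stops the motion and becomes the fourth contact. *)
Lemma chart_three_contacts (al : R) : 0 <= al <= PI / 2 -> 0 <= room m r al ->
  enclosed P (FR (axis_pt al 0)) (LIN (axis_dir al 0)) r -> gap m r x y z al 0 = 0 ->
  reaches P r (FR (axis_pt al 0)) (LIN (axis_dir al 0)).
Proof.
intros Hal Hroom He Hg.
destruct (tangent_curve m r x y z Hm Hr al) as (f & g & Cf & Cg & Ef & Eg & Hfg & Hs); auto.
rewrite <- Eg, <- Ef in He |- *.
destruct (chart_motion_or_contact f g Cf Cg) as [M|(T & HT & M & u & v & w & HI & E & t & Ht & N)]; auto.
{ intros t Ht; apply Hfg; auto. }
- apply reaches_motion with (1 := M 1 ltac:(lra)).
  destruct (Hfg 1 ltac:(lra)); apply chart_special; auto.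
  apply (motion_end _ _ _ _ _ _ (M 1 ltac:(lra))).
- apply reaches_motion with (1 := M).
  destruct (Hfg T HT) as [R1 R2], (Hfg t Ht) as [R3 R4].
  assert (HD := dot_self_1 _ (chart_dir_unit (f T) (g T))).
  assert (on : forall x y z, gap m r x y z (f T) (g T) = 0 ->
    on_cylinder (FR (axis_pt (f T) (g T))) (LIN (axis_dir (f T) (g T))) r (FR (mkpt x y z))).
  { intros; apply dist_line_eq_iff; auto; rewrite excess_chart; auto. }
  (* The stopping point is outside the cylinder at time [t], whereas the three others are still on
     it: it is a new point. *)
  assert (ne : forall a b c, gap m r a b c (f t) (g t) = 0 -> FR (mkpt a b c) <> FR (mkpt u v w)).
  { intros a b c G E'.
    assert (Z : gap m r a b c (f t) (g t) = gap m r u v w (f t) (g t)); [|lra].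
    rewrite <- !excess_chart by auto; rewrite E'; auto. }
  assert (G0 : forall s c, c * c = m * m -> gap m r 0 0 c (f s) (g s) = 0).
  { intros s c Hc; rewrite gap_on_axis, Hc; ring. }
  assert (NC := chart_not_collinear).
  exists (FR (axis_pt (f T) (g T))), (LIN (axis_dir (f T) (g T))).
  split; [auto|split; [apply (motion_end _ _ _ _ _ _ M)|split]].
  + apply (motion_intro P r (fun _ => FR (axis_pt (f T) (g T))) (fun _ => LIN (axis_dir (f T) (g T))));
      [intros s; repeat split; cont|intros s; repeat split; cont|].
    intros _ _; apply (motion_end _ _ _ _ _ _ M).
  + left; exists (FR (mkpt 0 0 (- m))), (FR (mkpt 0 0 m)), (FR (mkpt x y z)), (FR (mkpt u v w)).
    destruct chart_distinct as (D1 & D2 & D3).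
    assert (D4 := ne _ _ _ (G0 t (- m) ltac:(ring))); assert (D5 := ne _ _ _ (G0 t m eq_refl)).
    assert (D6 := ne _ _ _ R4).
    split; [auto|split; [auto|split; [auto|split; [auto|split; [|split]]]]].
    * repeat (apply NoDup_cons; [simpl; intuition congruence|]); apply NoDup_nil.
    * intros HC; apply NC; apply collinear_incl with (2 := HC); intros k; simpl; tauto.
    * split; [apply on, G0; ring|split; [apply on, G0; ring|split; apply on; auto]].
Qed.

End Third.

Lemma chart_reaches (al : R) : 0 < al <= PI / 2 -> 0 <= room m r al -> ~ collinear P ->
  enclosed P (FR (axis_pt al 0)) (LIN (axis_dir al 0)) r ->
  reaches P r (FR (axis_pt al 0)) (LIN (axis_dir al 0)).
Proof.
intros Hal Hroom NC He.
assert (Hs : 0 < sin al) by (apply sin_gt_0; pose proof PI_RGT_0; lra).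
pose (f t := al * (1 - t)).
assert (f0 : f 0 = al) by (unfold f; ring).
assert (Hft : forall t, 0 <= t <= 1 -> 0 <= f t <= al) by (intros t Ht; unfold f; nra).
assert (Hroom' : forall t, 0 <= t <= 1 -> 0 <= room m r (f t)).
{ intros t Ht; apply Rle_trans with (1 := Hroom); apply room_antitone; auto; lra. }
destruct (chart_motion_or_contact f (fun _ => 0)) as [M|(T & HT & M & x & y & z & HI & E & t & Ht & N)]; auto.
{ intros t; unfold f; cont. }
{ intros t; cont. }
{ rewrite f0; auto. }
- simpl in M; rewrite f0 in M; specialize (M 1 ltac:(lra)).
  replace (f 1) with 0 in M by (unfold f; ring).
  apply reaches_motion with (1 := M).
  assert (Hroom0 : 0 <= room m r 0) by (unfold room; rewrite sin_0; nra).
  destruct (motion_end _ _ _ _ _ _ M) as [_ He0].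
  assert (off : exists x y z, In (FR (mkpt x y z)) P /\ 0 < x * x + y * y).
  { apply NNPP; intros K; apply NC; exists o, f3; split.
    - apply dot_self_1, Hf.
    - intros X HX; destruct (fr_surj o f1 f2 f3 Hf X) as (x & y & z & ->).
      assert (x * x + y * y <= 0) by (apply Rnot_lt_le; intros L; apply K; exists x, y, z; auto).
      assert (x = 0) by nra; assert (y = 0) by nra; subst x y.
      exists z; unfold fr, lin; apply pt_ext; vring. }
  destruct (chart_motion_or_contact (fun _ => 0) (fun t => PI * t))
    as [M'|(T & HT & M' & x & y & z & HI & E & t & Ht & N)]; auto.
  { intros t; cont. }
  { intros t; cont. }
  { rewrite Rmult_0_r; auto. }
  (* At [al = 0] the gaps for [ph = 0] and [ph = PI] add up to [2 (x^2 + y^2)], so a point off the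
     line [pq] cannot be enclosed at both ends of the half turn. *)
  + exfalso; destruct off as (x & y & z & HX & Hxy).
    specialize (M' 1 ltac:(lra)); destruct (motion_end _ _ _ _ _ _ M') as [_ He1].
    pose proof (chart_enclosed _ _ _ _ _ Hroom0 He0 HX) as G0.
    pose proof (chart_enclosed _ _ _ _ _ Hroom0 He1 HX) as G1.
    revert G0 G1; unfold gap, rho, kap; rewrite Rmult_1_r, sin_0, !cos_0, cos_PI, sin_PI; lra.
  + rewrite Rmult_0_r in M'; apply reaches_motion with (1 := M').
    assert (Hxy : 0 < x * x + y * y).
    { apply Rnot_le_lt; intros L; assert (x = 0) by nra; assert (y = 0) by nra; subst x y.
      rewrite gap_on_axis, sin_0 in N; lra. }
    destruct (motion_end _ _ _ _ _ _ M') as [_ He1].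
    apply (chart_special x y z); auto.
    unfold special; rewrite sin_0; ring.
- simpl in M; rewrite f0 in M; apply reaches_motion with (1 := M).
  destruct (motion_end _ _ _ _ _ _ M) as [_ HeT].
  (* A point of the line [pq] enclosed at the start has [z^2 <= m^2], since [sin al > 0], and then
     never leaves. *)
  assert (Hxy : 0 < x * x + y * y).
  { apply Rnot_le_lt; intros L; assert (x = 0) by nra; assert (y = 0) by nra; subst x y.
    pose proof (chart_enclosed _ _ _ _ _ Hroom He HI) as G0.
    rewrite gap_on_axis in G0, N.
    assert (0 < sin al * sin al) by (apply Rmult_lt_0_compat; auto).
    assert (z * z - m * m <= 0) by nra.
    pose proof (Rle_0_sqr (sin (f t))) as S; unfold Rsqr in S; nra. }
  apply (chart_three_contacts x y z); auto.
  destruct (Hft T HT); lra.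
Qed.

End Chart.

(** * Reaching two contacts *)

Lemma excess_shift (a d v x : pt) (r : R) : dot d d = 1 -> dot v d = 0 ->
  excess (vadd a v) d r x = excess a d r x - 2 * dot (vsub x a) v + dot v v.
Proof.
intros Hd Hv; unfold excess.
replace (vsub x (vadd a v)) with (vsub (vsub x a) v) by (apply pt_ext; vring).
generalize (vsub x a); intros Y; dexp; rewrite Hd, Hv, (dot_sym v Y); ring.
Qed.

Lemma touch_one (P : list pt) (r : R) (a d p : pt) : 0 < r -> dot d d = 1 ->
  enclosed P a d r -> In p P ->
  exists a1 q, motion P r a d a1 d /\ In q P /\ excess a1 d r q = 0.
Proof.
intros Hr Hd He Pp; assert (Hd0 := dot_self_1 _ Hd).
destruct (perp_unit d Hd0) as (e & Hee & Hed).
assert (Ea : vadd a (vscale (3 * r * 0) e) = a) by (apply pt_ext; vring).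
(* A translation by [3 r], more than the diameter, cannot keep [p] enclosed. *)
destruct (motion_or_contact P r (fun t => vadd a (vscale (3 * r * t) e)) (fun _ => d))
  as [M|(T & HT & M & x & Hx & Ex & _)]; auto.
- intros t; repeat split; unfold vadd, vscale, mkpt, px, py, pz; simpl; cont.
- intros t; repeat split; cont.
- rewrite Ea; auto.
- exfalso; destruct (motion_end _ _ _ _ _ _ (M 1 ltac:(lra))) as [_ H1].
  specialize (He p Pp); specialize (H1 p Pp).
  apply dist_line_le_iff in He; auto; apply dist_line_le_iff in H1; auto.
  rewrite excess_shift in H1; auto; [|dexp; rewrite Hed; ring].
  revert He H1; unfold excess; rewrite Hd; generalize (vsub p a); intros Y; dexp; rewrite Hee; intros He H1.
  (* Bessel's inequality for the orthonormal vectors [d] and [e]. *)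
  assert (B : dot Y e * dot Y e <= dot Y Y - dot Y d * dot Y d).
  { pose proof (dot_pos (vsub (vsub Y (vscale (dot Y d) d)) (vscale (dot Y e) e))) as B; revert B.
    dexp; rewrite Hd, Hee, Hed, (dot_sym d e), Hed, (dot_sym d Y), (dot_sym e Y); lra. }
  assert (dot Y e <= r) by nra.
  nra.
- rewrite Ea in M; exists (vadd a (vscale (3 * r * T) e)), x; auto.
Qed.

Lemma touch_two (P : list pt) (r : R) (a d p : pt) : 0 < r -> dot d d = 1 ->
  enclosed P a d r -> In p P -> excess a d r p = 0 -> ~ collinear P ->
  exists a1 q, motion P r a d a1 d /\ In q P /\ excess a1 d r p = 0 /\ excess a1 d r q = 0 /\
    0 < dot (vsub q p) (vsub q p) - dot (vsub q p) d * dot (vsub q p) d.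
Proof.
intros Hr Hd He Pp Ep NC; assert (Hd0 := dot_self_1 _ Hd).
(* [y0] is the vector from [p] to its foot on the axis; with [y1] it spans the plane orthogonal to
   [d], and [y t] turns by [PI] in that plane. *)
pose (t0 := - dot (vsub a p) d); pose (y0 := vsub (vadd a (vscale t0 d)) p).
pose (y1 := cross d y0).
assert (H0d : dot y0 d = 0).
{ unfold y0, t0; transitivity (dot (vsub a p) d * (1 - dot d d)); [vring|rewrite Hd; ring]. }
assert (H1d : dot y1 d = 0) by apply cross_dot_l.
assert (H10 : dot y1 y0 = 0) by apply cross_dot_r.
assert (H00 : dot y0 y0 = r * r).
{ unfold y0, t0; revert Ep; unfold excess.
  replace (vsub p a) with (vscale (-1) (vsub a p)) by (apply pt_ext; vring).
  replace (vsub (vadd a (vscale (- dot (vsub a p) d) d)) p) with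
    (vadd (vsub a p) (vscale (- dot (vsub a p) d) d)) by (apply pt_ext; vring).
  generalize (vsub a p); intros Y; dexp; rewrite Hd, (dot_sym d Y); lra. }
assert (H11 : dot y1 y1 = r * r).
{ unfold y1; rewrite cross_norm, Hd, H00, (dot_sym d y0), H0d; ring. }
pose (y t := vadd (vscale (cos (PI * t)) y0) (vscale (sin (PI * t)) y1)).
assert (Hyd : forall t, dot (y t) d = 0) by (intros t; unfold y; dexp; rewrite H0d, H1d; ring).
assert (Hyy : forall t, dot (y t) (y t) = r * r).
{ intros t; unfold y; dexp; rewrite H00, H11, H10, (dot_sym y0 y1), H10.
  pose proof (sin2_cos2 (PI * t)) as E; unfold Rsqr in E.
  transitivity (r * r * (sin (PI * t) * sin (PI * t) + cos (PI * t) * cos (PI * t))); [ring|rewrite E; ring]. }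
assert (Hex : forall t x, excess (vadd p (y t)) d r x =
  dot (vsub x p) (vsub x p) - dot (vsub x p) d * dot (vsub x p) d - 2 * dot (vsub x p) (y t)).
{ intros t x; rewrite excess_shift, Hyy by auto; unfold excess; rewrite Hd; ring. }
assert (M0 : motion P r a d (vadd p (y 0)) d).
{ pose proof (motion_same_line P a d r t0 1 Rlt_0_1 Hd0 He) as M.
  replace (vscale 1 d) with d in M by (apply pt_ext; vring).
  replace (vadd p (y 0)) with (vadd a (vscale t0 d)); auto.
  unfold y; rewrite Rmult_0_r, cos_0, sin_0; generalize y1; intros; unfold y0; apply pt_ext; vring. }
assert (off : exists x, In x P /\ 0 < dot (vsub x p) (vsub x p) - dot (vsub x p) d * dot (vsub x p) d).
{ apply NNPP; intros N; apply NC; exists p, d; split; auto.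
  intros x Hx; exists (dot (vsub x p) d).
  assert (L : dot (vsub x p) (vsub x p) - dot (vsub x p) d * dot (vsub x p) d <= 0)
    by (apply Rnot_lt_le; intros L; apply N; eauto).
  assert (Z : vsub (vsub x p) (vscale (dot (vsub x p) d) d) = zero).
  { apply dot_self_0, Rle_antisym; [|apply dot_pos].
    revert L; generalize (vsub x p); intros Y; dexp; rewrite Hd, (dot_sym d Y); lra. }
  revert Z; generalize (dot (vsub x p) d); intros k Z.
  apply pt_ext; [apply (f_equal px) in Z|apply (f_equal py) in Z|apply (f_equal pz) in Z];
    revert Z; clear; vring; lra. }
destruct (motion_or_contact P r (fun t => vadd p (y t)) (fun _ => d))
  as [M|(T & HT & M & x & Hx & Ex & t & Ht & Nx)]; auto.
- intros t; repeat split; unfold y, vadd, vscale, mkpt, px, py, pz; simpl; cont.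
- intros t; repeat split; cont.
- apply (motion_end _ _ _ _ _ _ M0).
(* Since [y 1 = - y 0], the excesses of [x] at the two ends add up to twice its squared projected
   distance from [p], which is positive. *)
- exfalso; destruct off as (x & Hx & Hpos).
  destruct (motion_end _ _ _ _ _ _ M0) as [_ G0].
  destruct (motion_end _ _ _ _ _ _ (M 1 ltac:(lra))) as [_ G1].
  specialize (G0 x Hx); specialize (G1 x Hx).
  apply dist_line_le_iff in G0; auto; apply dist_line_le_iff in G1; auto.
  rewrite Hex in G0, G1; revert Hpos G0 G1; unfold y; generalize (vsub x p); intros Y; dexp.
  rewrite (Rmult_0_r PI), Rmult_1_r, cos_0, sin_0, cos_PI, sin_PI; lra.
- exists (vadd p (y T)), x; split; [apply motion_trans with (1 := M0); auto|split; [auto|split; [|split; [auto|]]]].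
  + rewrite Hex; replace (vsub p p) with zero by (apply pt_ext; vring); vring.
  (* A point with the same projection as [p] has excess [0] during the whole roll and would not have
     left the cylinder. *)
  + apply Rnot_le_lt; intros L.
    assert (Z : vsub (vsub x p) (vscale (dot (vsub x p) d) d) = zero).
    { apply dot_self_0, Rle_antisym; [|apply dot_pos].
      revert L; generalize (vsub x p); intros Y; dexp; rewrite Hd, (dot_sym d Y); lra. }
    assert (Z' : dot (vsub x p) (y t) = 0).
    { assert (Z' : dot (vsub (vsub x p) (vscale (dot (vsub x p) d) d)) (y t) = 0) by (rewrite Z; vring).
      revert Z'; rewrite dot_sub_l, dot_scale_l, (dot_sym d), Hyd; lra. }
    rewrite Hex, Z' in Nx; lra.
Qed.

(** Gram-Schmidt: [f3] is along [e], [f1] along the part of [d] orthogonal to [e], and [f2] along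
    [y]. If [y = 0], [f2] is completed by a cross product. *)
Lemma frame_through (d e y : pt) : dot d d = 1 -> 0 < dot e e - dot e d * dot e d ->
  dot y d = 0 -> dot y e = 0 ->
  exists f1 f2 f3, orthonormal f1 f2 f3 /\
    e = vscale (sqrt (dot e e)) f3 /\ y = vscale (sqrt (dot y y)) f2 /\
    d = vadd (vscale (sqrt (1 - dot d f3 * dot d f3)) f1) (vscale (dot d f3) f3).
Proof.
intros Hd Hed Hyd Hye.
assert (Hee : 0 < dot e e) by (pose proof (Rle_0_sqr (dot e d)) as Q; unfold Rsqr in Q; lra).
set (n := sqrt (dot e e)); assert (Hn : 0 < n) by (apply sqrt_lt_R0; auto).
assert (Hnn : n * n = dot e e) by (apply sqrt_sqrt; lra).
set (f3 := vscale (/ n) e).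
assert (E : e = vscale n f3) by (apply pt_ext; unfold f3; vring; field; lra).
assert (H33 : dot f3 f3 = 1) by (unfold f3; dexp; rewrite <- Hnn; field; lra).
assert (Hyf3 : dot y f3 = 0) by (unfold f3; dexp; rewrite Hye; ring).
set (c := dot d f3).
assert (Hc : 0 < 1 - c * c).
{ replace (dot e e - dot e d * dot e d) with (n * n * (1 - c * c)) in Hed.
  - apply Rmult_lt_reg_l with (n * n); [nra|lra].
  - unfold c; rewrite <- Hnn; rewrite E; dexp; rewrite (dot_sym f3 d); ring. }
set (s := sqrt (1 - c * c)); assert (Hs : 0 < s) by (apply sqrt_lt_R0; auto).
assert (Hss : s * s = 1 - c * c) by (apply sqrt_sqrt; lra).
set (f1 := vscale (/ s) (vsub d (vscale c f3))).
assert (Dd : d = vadd (vscale s f1) (vscale c f3)) by (apply pt_ext; unfold f1; vring; field; lra).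
assert (H11 : dot f1 f1 = 1).
{ unfold f1; dexp; rewrite Hd, H33, (dot_sym f3 d); fold c.
  transitivity (/ s * (/ s * (1 - c * c))); [ring|rewrite <- Hss; field; lra]. }
assert (H13 : dot f1 f3 = 0) by (unfold f1; dexp; rewrite H33; fold c; ring).
assert (Hyf1 : dot y f1 = 0) by (unfold f1; dexp; rewrite Hyd, Hyf3; ring).
assert (F2 : exists f2, dot f2 f2 = 1 /\ dot f1 f2 = 0 /\ dot f2 f3 = 0 /\ y = vscale (sqrt (dot y y)) f2).
{ destruct (Rle_lt_or_eq_dec _ _ (dot_pos y)) as [Hy|Hy].
  - assert (Hk : 0 < sqrt (dot y y)) by (apply sqrt_lt_R0; auto).
    exists (vscale (/ sqrt (dot y y)) y); repeat split.
    + dexp; rewrite <- (sqrt_sqrt (dot y y)) at 3 by lra; field; lra.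
    + dexp; rewrite (dot_sym f1 y), Hyf1; ring.
    + dexp; rewrite Hyf3; ring.
    + revert Hk; generalize (sqrt (dot y y)); intros k Hk; apply pt_ext; vring; field; lra.
  - exists (cross f3 f1); repeat split.
    + rewrite cross_norm, H33, H11, (dot_sym f3 f1), H13; ring.
    + rewrite dot_sym; apply cross_dot_r.
    + apply cross_dot_l.
    + rewrite <- Hy, sqrt_0; symmetry in Hy; apply dot_self_0 in Hy; rewrite Hy at 1; apply pt_ext; vring. }
destruct F2 as (f2 & H22 & H12 & H23 & Y).
exists f1, f2, f3; repeat split; auto.
Qed.

(** Moves the line into the chart of [p] and [q]. The vector [y] from the midpoint to the nearest
    point of the axis is orthogonal to [pq] because both contacts are at the same distance from the
    axis. The sign of [<q - p, d>] puts the angle in the range up to [PI / 2]. *)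
Lemma two_contacts_reaches (P : list pt) (r : R) (a d p q : pt) : 0 < r -> dot d d = 1 ->
  enclosed P a d r -> ~ collinear P -> In p P -> In q P ->
  excess a d r p = 0 -> excess a d r q = 0 ->
  0 < dot (vsub q p) (vsub q p) - dot (vsub q p) d * dot (vsub q p) d ->
  0 <= dot (vsub q p) d -> reaches P r a d.
Proof.
intros Hr Hd He NC Pp Pq Ep Eq Hproj Hangle.
assert (Hd0 := dot_self_1 _ Hd).
pose (e := vsub q p); pose (o := vscale (/ 2) (vadd p q)); pose (W := vsub o a).
pose (y := vsub (vscale (dot W d) d) W).
fold e in Hproj, Hangle.
(* The two contact equations seen from the midpoint: their difference gives [Hye], their sum
   [Hyy]. *)
assert (Ep' : dot W W - dot W e + dot e e / 4 - (dot W d - dot e d / 2) * (dot W d - dot e d / 2) = r * r).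
{ revert Ep; unfold excess; rewrite Hd.
  replace (vsub p a) with (vsub W (vscale (/ 2) e)) by (unfold W, o, e; apply pt_ext; vring; field).
  clearbody W e; dexp; rewrite (dot_sym e W); lra. }
assert (Eq' : dot W W + dot W e + dot e e / 4 - (dot W d + dot e d / 2) * (dot W d + dot e d / 2) = r * r).
{ revert Eq; unfold excess; rewrite Hd.
  replace (vsub q a) with (vadd W (vscale (/ 2) e)) by (unfold W, o, e; apply pt_ext; vring; field).
  clearbody W e; dexp; rewrite (dot_sym e W); lra. }
assert (Hyd : dot y d = 0) by (unfold y; dexp; rewrite Hd; ring).
assert (Hye : dot y e = 0) by (unfold y; dexp; rewrite (dot_sym d e); lra).
assert (Hyy : dot y y = r * r - (dot e e - dot e d * dot e d) / 4).
{ unfold y; dexp; rewrite Hd, (dot_sym d W); lra. }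
destruct (frame_through d e y Hd Hproj Hyd Hye) as (f1 & f2 & f3 & Hf & E & Y & D).
assert (Hee : 0 < dot e e) by (pose proof (Rle_0_sqr (dot e d)) as Q; unfold Rsqr in Q; lra).
set (n := sqrt (dot e e)) in *; assert (Hn : 0 < n) by (apply sqrt_lt_R0; auto).
assert (Hnn : n * n = dot e e) by (apply sqrt_sqrt; lra).
set (c := dot d f3) in *.
assert (Hec : dot e d = n * c) by (rewrite E, dot_scale_l, dot_sym; auto).
assert (Hc0 : 0 <= c) by (apply Rmult_le_reg_l with n; lra).
assert (Hc1 : c < 1).
{ rewrite Hec, <- Hnn in Hproj; apply Rnot_le_lt; intros L.
  assert (0 < n * n) by (apply Rmult_lt_0_compat; auto).
  assert (1 <= c * c) by nra.
  assert (n * n * 1 <= n * n * (c * c)) by (apply Rmult_le_compat_l; lra); lra. }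
pose (al := acos c).
assert (Hcos : cos al = c) by (apply cos_acos; lra).
assert (Hsin : sin al = sqrt (1 - c * c)) by (unfold al; rewrite sin_acos by lra; reflexivity).
assert (Hal : 0 < al <= PI / 2).
{ destruct (acos_bound c) as [B1 B2]; fold al in B1, B2; split.
  - destruct (Req_dec al 0) as [Z|]; [|lra]; rewrite Z, cos_0 in Hcos; lra.
  - apply Rnot_lt_le; intros L; assert (cos al < 0); [|lra].
    apply cos_lt_0; pose proof PI_RGT_0; lra. }
assert (Hss : sin al * sin al = 1 - c * c).
{ rewrite Hsin; apply sqrt_sqrt; nra. }
assert (Hroom : room (n / 2) r al = dot y y).
{ unfold room; rewrite Hss, Hyy, Hec, <- Hnn; field. }
assert (Hm : 0 < n / 2) by lra.
assert (Pp' : p = fr o f1 f2 f3 (mkpt 0 0 (- (n / 2)))).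
{ unfold fr, lin; transitivity (vsub o (vscale (/ 2) e)).
  - unfold o, e; apply pt_ext; vring; field.
  - rewrite E; clearbody o n; apply pt_ext; vring; field. }
assert (Pq' : q = fr o f1 f2 f3 (mkpt 0 0 (n / 2))).
{ unfold fr, lin; transitivity (vadd o (vscale (/ 2) e)).
  - unfold o, e; apply pt_ext; vring; field.
  - rewrite E; clearbody o n; apply pt_ext; vring; field. }
assert (A' : vadd a (vscale (dot W d) d) = fr o f1 f2 f3 (axis_pt r (n / 2) al 0)).
{ transitivity (vadd o y).
  - unfold y, W; apply pt_ext; vring.
  - unfold axis_pt, waist; rewrite Hroom, sin_0, cos_0; rewrite Y at 1.
    unfold fr, lin; apply pt_ext; vring. }
assert (D' : vscale 1 d = lin f1 f2 f3 (axis_dir al 0)).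
{ unfold axis_dir; rewrite sin_0, cos_0, Hcos, Hsin; rewrite D at 1.
  unfold lin; clearbody c; apply pt_ext; vring. }
assert (M := motion_same_line P a d r (dot W d) 1 Rlt_0_1 Hd0 He).
rewrite A', D' in M; apply reaches_motion with (1 := M).
rewrite Pp' in Pp; rewrite Pq' in Pq.
apply chart_reaches; auto.
- rewrite Hroom; apply dot_pos.
- apply (motion_end _ _ _ _ _ _ M).
Qed.

Theorem theorem1 (P : list pt) (r : R) (a d : pt) :
  (4 <= length P)%nat -> NoDup P -> ~ collinear P -> 0 < r ->
  d <> zero -> enclosed P a d r ->
  exists a' d' : pt,
    d' <> zero /\ enclosed P a' d' r /\ motion P r a d a' d' /\
    ((exists p1 p2 p3 p4,
        In p1 P /\ In p2 P /\ In p3 P /\ In p4 P /\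
        NoDup (p1 :: p2 :: p3 :: p4 :: nil) /\
        ~ collinear (p1 :: p2 :: p3 :: p4 :: nil) /\
        on_cylinder a' d' r p1 /\ on_cylinder a' d' r p2 /\
        on_cylinder a' d' r p3 /\ on_cylinder a' d' r p4)
     \/
     (exists p q s,
        In p P /\ In q P /\ In s P /\
        ~ collinear (p :: q :: s :: nil) /\
        on_cylinder a' d' r p /\ on_cylinder a' d' r q /\ on_cylinder a' d' r s /\
        (cond_a p q a' d' r \/ cond_b p q a' d' r \/ cond_c p q a' d' r))).
Proof.
intros _ _ NC Hr Hd He; change (reaches P r a d).
assert (Hdd := dot_self_pos d Hd); assert (Hs : 0 < sqrt (dot d d)) by (apply sqrt_lt_R0; auto).
pose proof (motion_same_line P a d r 0 (/ sqrt (dot d d)) (Rinv_0_lt_compat _ Hs) Hd He) as M.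
apply reaches_motion with (1 := M).
set (u := vscale (/ sqrt (dot d d)) d) in *; set (a0 := vadd a (vscale 0 d)) in *.
assert (Hu : dot u u = 1).
{ unfold u; dexp; rewrite <- (sqrt_sqrt (dot d d)) at 3 by lra; field; lra. }
destruct (motion_end _ _ _ _ _ _ M) as [_ He0].
destruct P as [|p0 l] eqn:EP.
{ elim NC; exists zero, u; split; [apply dot_self_1; auto|intros x []]. }
rewrite <- EP in *.
assert (P0 : In p0 P) by (rewrite EP; left; auto).
destruct (touch_one P r a0 u p0 Hr Hu He0 P0) as (a1 & p & M1 & Pp & Ep).
apply reaches_motion with (1 := M1).
destruct (motion_end _ _ _ _ _ _ M1) as [_ He1].
destruct (touch_two P r a1 u p Hr Hu He1 Pp Ep NC) as (a2 & q & M2 & Pq & Ep2 & Eq2 & Hproj).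
apply reaches_motion with (1 := M2).
destruct (motion_end _ _ _ _ _ _ M2) as [_ He2].
(* Exchanging [p] and [q] makes the angle between [pq] and the axis at most [PI / 2]. *)
destruct (Rle_or_lt 0 (dot (vsub q p) u)) as [H|H].
- apply (two_contacts_reaches P r a2 u p q); auto.
- assert (Hsym : forall v, dot (vsub p q) v = - dot (vsub q p) v) by vring.
  apply (two_contacts_reaches P r a2 u q p); auto.
  + rewrite !Hsym, (dot_sym (vsub q p) (vsub p q)), Hsym; lra.
  + rewrite Hsym; lra.
Qed.
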